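(* Let $n\ge2$ and let $F=u\,\phi(r,s)$ be a spherically symmetric Finsler metric on the ball $\mathbb{B}^n(r_0)\subset\mathbb{R}^n$, with $R_1$, $R_3$ defined from $\phi$ as in the context. Then $F$ is of scalar curvature $K=K(x,y)$ (for some function $K$) if and only if either $n=2$, or $R_1=K\phi^2$ and $R_3=0$ (with $K$ the same function as the scalar curvature).
   Context: Notation: for $x\in\mathbb{B}^n(r_0)$ (the open ball of radius $r_0$ centred at $0$) and $y\in\mathbb{R}^n\setminus\{0\}$ put $r=|x|$, $u=|y|$, $s=\langle x,y\rangle/|y|$ (Euclidean norm and inner product). Subscripts $r,s$ on functions of $(r,s)$ denote partial derivatives. Summation over repeated indices is understood. A Finsler metric $F$ is a function on the tangent bundle that is positive and smooth for $y\neq 0$, positively homogeneous of degree 1 in $y$, and such that $g_{jk}=\frac12\frac{\partial^2F^2}{\partial y^j\partial y^k}$ has rank $n$ for $y\ne0$. It is spherically symmetric if $F=u\,\phi(r,s)$ with $\phi$ a positive smooth function (defined for $|s|\le r<r_0$). Such an $F$ is regular iff $\phi-s\phi_s+(r^2-s^2)\phi_{ss}>0$ and, when $n\ge3$, also $\phi-s\phi_s>0$, for all $|s|\le r<r_0$. The geodesic spray of $F$ is $S=y^i\frac{\partial}{\partial x^i}-2G^i\frac{\partial}{\partial y^i}$ with $G^i=uP\,y^i+u^2Q\,x^i$, where $$Q=\frac{1}{2r}\,\frac{-\phi_r+s\phi_{rs}+r\phi_{ss}}{\phi-s\phi_s+(r^2-s^2)\phi_{ss}},\qquad P=-\frac{Q}{\phi}\bigl(s\phi+(r^2-s^2)\phi_s\bigr)+\frac{1}{2r\phi}(s\phi_r+r\phi_s).$$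 With $G^i_j=\partial G^i/\partial y^j$, the Riemann curvature has components $R^i_j=2\frac{\partial G^i}{\partial x^j}-S(G^i_j)-G^i_kG^k_j$. All identities are understood where $x\ne0$, $y\neq0$. $F$ is of scalar (flag) curvature $K=K(x,y)$ if $$R^i_j=KF^2\Bigl(\delta^i_j-\frac{y^i}{F}\frac{\partial F}{\partial y^j}\Bigr).$$ Define $$R_1=2Q-\tfrac{s}{r}P_r-P_s+2(r^2-s^2)P_sQ+P^2+2sPQ,$$ $$R_3=\tfrac{2}{r}Q_r-Q_{ss}-\tfrac{s}{r}Q_{rs}+2(r^2-s^2)QQ_{ss}+4Q^2-(r^2-s^2)Q_s^2-2sQQ_s,$$ $$R_5=\tfrac{2}{r}P_r-\tfrac{s}{r}P_{rs}-P_{ss}-Q_s+2PQ-2sP_sQ+2(r^2-s^2)P_{ss}Q-PP_s-sPQ_s-(r^2-s^2)P_sQ_s.$$ Then $R^i_j=u^2R_1\delta^i_j+R_2y^iy_j+u^2R_3x^ix_j+uR_4x^iy_j+uR_5x_jy^i$ with $R_4=-sR_3$ and $R_2=-R_1-sR_5$, where $x_i=x^i$, $y_i=y^i$. *)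

(* Defs.v *)
From mathcomp Require Import all_boot all_order all_algebra.
From mathcomp Require Import all_classical all_reals all_analysis.

Set Implicit Arguments.
Unset Strict Implicit.
Unset Printing Implicit Defensive.

Import Order.TTheory GRing.Theory Num.Theory.
Import numFieldNormedType.Exports.

Local Open Scope classical_set_scope.
Local Open Scope ring_scope.

(* The library norm on row vectors is the sup norm, hence these two. *)
Definition dotp (R : realType) n (x y : 'rV[R]_n) : R :=
  \sum_(i < n) x ord0 i * y ord0 i.

Definition enorm (R : realType) n (x : 'rV[R]_n) : R := Num.sqrt (dotp x x).

(* In finite dimension, having on an open set [U] all iterated directional
   derivatives up to order [k], continuous, is being of class C^k on [U]. *)
Fixpoint Ck (R : realType) (V : normedModType R) (k : nat) (U : set V)
    (f : V -> R) : Prop :=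
  (forall x, U x -> {for x, continuous f}) /\
  (if k is k'.+1 then
     forall v : V, (forall x, U x -> derivable f x v) /\
                   Ck k' U (fun x => 'D_v f x)
   else True).

Definition smooth_on (R : realType) (V : normedModType R) (U : set V)
    (f : V -> R) : Prop := forall k, Ck k U f.

Definition partial_x (R : realType) n (j : 'I_n)
    (f : 'rV[R]_n -> 'rV[R]_n -> R) (x y : 'rV[R]_n) : R :=
  'D_(delta_mx ord0 j) (fun z => f z y) x.

Definition partial_y (R : realType) n (j : 'I_n)
    (f : 'rV[R]_n -> 'rV[R]_n -> R) (x y : 'rV[R]_n) : R :=
  'D_(delta_mx ord0 j) (f x) y.

Definition fundamental_tensor (R : realType) n
    (F : 'rV[R]_n -> 'rV[R]_n -> R) (x y : 'rV[R]_n) : 'M[R]_n :=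
  \matrix_(j, k)
    (2^-1 * partial_y j (partial_y k (fun x' y' => F x' y' ^+ 2)) x y).

Record is_finsler (R : realType) n (r0 : R)
    (F : 'rV[R]_n -> 'rV[R]_n -> R) : Prop := {
  finsler_smooth :
    smooth_on [set p : 'rV[R]_n * 'rV[R]_n | enorm p.1 < r0 /\ p.2 != 0]
      (fun p => F p.1 p.2);
  finsler_gt0 : forall x y, enorm x < r0 -> y != 0 -> 0 < F x y;
  finsler_homog : forall x y (t : R), enorm x < r0 -> y != 0 -> 0 < t ->
    F x (t *: y) = t * F x y;
  finsler_rank : forall x y, enorm x < r0 -> y != 0 ->
    \rank (fundamental_tensor F x y) = n
}.

(* [phi] only matters on [rs_domain r0]. That set is not open, so smoothness
   means, as usual, smoothness of an extension to an open neighbourhood; [phi]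
   denotes such an extension. By density of the interior, the derivatives of
   [phi] on [rs_domain r0] do not depend on the extension chosen. *)
Definition rs_domain (R : realType) (r0 : R) : set (R * R) :=
  [set p | `|p.2| <= p.1 /\ p.1 < r0].

Definition smooth_rs (R : realType) (r0 : R) (phi : R -> R -> R) : Prop :=
  exists U : set (R * R), [/\ open U, rs_domain r0 `<=` U &
    smooth_on U (fun p : R * R => phi p.1 p.2)].

Definition rs_s (R : realType) n (x y : 'rV[R]_n) : R := dotp x y / enorm y.

Definition spherically_symmetric (R : realType) n (r0 : R) (phi : R -> R -> R)
    (F : 'rV[R]_n -> 'rV[R]_n -> R) : Prop :=
  [/\ smooth_rs r0 phi,
      (forall p, rs_domain r0 p -> 0 < phi p.1 p.2) &
      (forall x y, enorm x < r0 -> y != 0 ->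
         F x y = enorm y * phi (enorm x) (rs_s x y))].

Definition d_r (R : realType) (f : R -> R -> R) (r s : R) : R :=
  derive1 (fun t => f t s) r.

Definition d_s (R : realType) (f : R -> R -> R) (r s : R) : R :=
  derive1 (f r) s.

Section SphericalSpray.
Context (R : realType) (phi : R -> R -> R).

Definition spray_Q (r s : R) : R :=
  1 / (2 * r) *
  ((- d_r phi r s + s * d_s (d_r phi) r s + r * d_s (d_s phi) r s) /
   (phi r s - s * d_s phi r s + (r ^+ 2 - s ^+ 2) * d_s (d_s phi) r s)).

Definition spray_P (r s : R) : R :=
  - (spray_Q r s / phi r s) *
    (s * phi r s + (r ^+ 2 - s ^+ 2) * d_s phi r s) +
  1 / (2 * r * phi r s) * (s * d_r phi r s + r * d_s phi r s).

Let P := spray_P.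
Let Q := spray_Q.

Definition curv_R1 (r s : R) : R :=
  2 * Q r s - s / r * d_r P r s - d_s P r s
  + 2 * (r ^+ 2 - s ^+ 2) * d_s P r s * Q r s
  + P r s ^+ 2 + 2 * s * P r s * Q r s.

Definition curv_R3 (r s : R) : R :=
  2 / r * d_r Q r s - d_s (d_s Q) r s - s / r * d_s (d_r Q) r s
  + 2 * (r ^+ 2 - s ^+ 2) * Q r s * d_s (d_s Q) r s
  + 4 * Q r s ^+ 2 - (r ^+ 2 - s ^+ 2) * d_s Q r s ^+ 2
  - 2 * s * Q r s * d_s Q r s.

Context (n : nat).

Definition spray_G (i : 'I_n) (x y : 'rV[R]_n) : R :=
  enorm y * P (enorm x) (rs_s x y) * y ord0 i +
  enorm y ^+ 2 * Q (enorm x) (rs_s x y) * x ord0 i.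

End SphericalSpray.

Definition spray (R : realType) n (G : 'I_n -> 'rV[R]_n -> 'rV[R]_n -> R)
    (f : 'rV[R]_n -> 'rV[R]_n -> R) (x y : 'rV[R]_n) : R :=
  \sum_(i < n) (y ord0 i * partial_x i f x y
                - 2 * G i x y * partial_y i f x y).

Definition riemann (R : realType) n (G : 'I_n -> 'rV[R]_n -> 'rV[R]_n -> R)
    (x y : 'rV[R]_n) (i j : 'I_n) : R :=
  2 * partial_x j (G i) x y - spray G (partial_y j (G i)) x y
  - \sum_(k < n) partial_y k (G i) x y * partial_y j (G k) x y.

(* [phi] enters only through the coefficients of the geodesic spray of [F]. *)
Definition scalar_curvature (R : realType) n (r0 : R) (phi : R -> R -> R)
    (F K : 'rV[R]_n -> 'rV[R]_n -> R) : Prop :=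
  forall x y : 'rV[R]_n, enorm x < r0 -> x != 0 -> y != 0 ->
  forall i j : 'I_n,
    riemann (spray_G phi (n:=n)) x y i j =
    K x y * F x y ^+ 2 *
      ((i == j)%:R - y ord0 i / F x y * partial_y j F x y).

Definition R1_R3_condition (R : realType) n (r0 : R) (phi : R -> R -> R)
    (K : 'rV[R]_n -> 'rV[R]_n -> R) : Prop :=
  forall x y : 'rV[R]_n, enorm x < r0 -> x != 0 -> y != 0 ->
    curv_R1 phi (enorm x) (rs_s x y) =
      K x y * phi (enorm x) (rs_s x y) ^+ 2 /\
    curv_R3 phi (enorm x) (rs_s x y) = 0.

(* Main.v *)
(* Put w = x - (s/u) y, the component of x normal to y. The formulas for P and Q
   say that S(F) = 0 and that F is parallel for the connection G^i_j; one more
   differentiation gives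
     phi R5 = - phi_s R1 - (s phi + (r^2 - s^2) phi_s) R3,
   by which the Riemann curvature takes the form
     R^i_j = u^2 R1 h^i_j + u^2 R3 (w^i - |w|^2 (phi_s / phi) y^i / u) w_j
   with h^i_j = delta^i_j - y^i F_{y^j} / F and |w|^2 = r^2 - s^2.
   If n >= 3, contraction with a vector normal to x and y isolates R1, and
   contraction with w then isolates R3 when x and y are independent; the
   remaining case is a limit of this one. If n = 2, then
   w_i w_j = |w|^2 (delta_ij - y_i y_j / u^2), so the second term is a multiple
   of h^i_j too. The denominator of Q does not vanish, since otherwise the
   fundamental tensor would annihilate a nonzero vector on which dF vanishes. *)
Require Import Defs.
From mathcomp Require Import all_boot all_order all_algebra.
From mathcomp Require Import all_classical all_reals all_analysis.
From mathcomp Require Import ring.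

Set Implicit Arguments.
Unset Strict Implicit.
Unset Printing Implicit Defensive.

Import Order.TTheory GRing.Theory Num.Theory.
Import numFieldNormedType.Exports.
Local Open Scope classical_set_scope.
Local Open Scope ring_scope.

(** * Iterated derivatives *)

(** [Ck] offers only iterated directional derivatives, while the functions of (r, s) are met
    composed with norms and inner products. The chain rule in two variables and the symmetry of
    mixed derivatives therefore come from the mean value theorem and the continuity of partial
    derivatives. All derivatives in (x, y) are taken along lines t |-> (t a + x, t b + y) at t = 0.
    There every quantity depends on the direction only through inner products and components, so
    each tensor identity splits into a contraction of sums over indices and a rational identity
    between scalars, which is left to [field]. In the relation for R5, P and Q are treated as
    unknowns subject to two equations; the higher derivatives of phi hidden in their derivatives are
    never expanded. These equations must be differentiated on an open set, whereas the positivity of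
    phi and the rank condition speak only of the points (|x|, s). Hence the passage to an open set
    on which r, phi and the denominator of Q do not vanish. *)

Section IteratedDerivatives.
Variables (R : realType) (V : normedModType R).
Implicit Types (U : set V) (f g : V -> R) (k : nat).

Lemma Ck_continuous k U f x : Ck k U f -> U x -> {for x, continuous f}.
Proof. by case: k => [|k] [cf _] /cf. Qed.

Lemma CkW k U f : Ck k.+1 U f -> Ck k U f.
Proof.
elim: k f => [|k IHk] f [cf df]; first by split.
by split=> // v; have [dfv Cdf] := df v; split=> //; exact: IHk.
Qed.

Lemma Ck_subset k U W f : U `<=` W -> Ck k W f -> Ck k U f.
Proof.
move=> UW; elim: k f => [|k IHk] f [cf df]; (split=> [x /UW/cf//|//]).
by move=> v; have [dfv Cdf] := df v; split=> [x /UW/dfv//|]; exact: IHk.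
Qed.

(** Openness turns equality on [U] into equality near each point, and this is what passes to
    derivatives. *)
Lemma eq_Ck k U f g : open U -> (forall x, U x -> f x = g x) ->
  Ck k U f -> Ck k U g.
Proof.
move=> oU; have near_fg f' g' x : (forall x, U x -> f' x = g' x) -> U x ->
    \near x, f' x = g' x.
  by move=> fg Ux; apply: filterS (open_nbhs_nbhs (conj oU Ux)).
elim: k f g => [|k IHk] f g fg [cf df]; (split=> [x Ux|//]).
- rewrite /prop_for /continuous_at -(fg _ Ux).
  by apply: cvg_trans (cf _ Ux); apply: near_eq_cvg; exact: near_fg.
- rewrite /prop_for /continuous_at -(fg _ Ux).
  by apply: cvg_trans (cf _ Ux); apply: near_eq_cvg; exact: near_fg.
move=> v; have [dfv Cdf] := df v; split=> [x Ux|].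
  exact: near_eq_derivable (near_fg _ _ _ fg Ux) (dfv _ Ux).
apply: IHk Cdf => x Ux; apply: near_eq_derive; exact: near_fg.
Qed.

Lemma Ck_cst k U (c : R) : open U -> Ck k U (fun=> c).
Proof.
elim: k c => [|k IHk] c oU; split=> //.
- by move=> x _; exact: cst_continuous.
- by move=> x _; exact: cst_continuous.
move=> v; split=> [x _|]; first exact: derivable_cst.
by apply: (eq_Ck oU) (IHk 0 oU) => x _; rewrite derive_cst.
Qed.

Lemma CkD k U f g : open U -> Ck k U f -> Ck k U g ->
  Ck k U (fun x => f x + g x).
Proof.
move=> oU; elim: k f g => [|k IHk] f g [cf df] [cg dg]; split=> //.
- by move=> x Ux; apply: continuousD; [exact: cf|exact: cg].
- by move=> x Ux; apply: continuousD; [exact: cf|exact: cg].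
move=> v; have [dfv Cdf] := df v; have [dgv Cdg] := dg v; split=> [x Ux|].
  by apply: (@derivableD _ _ _ f g); [exact: dfv|exact: dgv].
apply: eq_Ck oU _ (IHk _ _ Cdf Cdg) => x Ux.
by rewrite (@deriveD _ _ _ f g) //; [exact: dfv|exact: dgv].
Qed.

Lemma CkM k U f g : open U -> Ck k U f -> Ck k U g ->
  Ck k U (fun x => f x * g x).
Proof.
move=> oU; elim: k f g => [|k IHk] f g Cf Cg.
  by split=> // x Ux; apply: continuousM; [exact: Cf.1|exact: Cg.1].
have [cf df] := Cf; have [cg dg] := Cg; split.
  by move=> x Ux; apply: continuousM; [exact: cf|exact: cg].
move=> v; have [dfv Cdf] := df v; have [dgv Cdg] := dg v; split=> [x Ux|].
  by apply: (@derivableM _ _ f g); [exact: dfv|exact: dgv].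
apply: eq_Ck oU _ (CkD oU (IHk _ _ (CkW Cf) Cdg) (IHk _ _ (CkW Cg) Cdf)) => x Ux.
by rewrite (@deriveM _ _ f g) //; [exact: dfv|exact: dgv].
Qed.

(** The derivative of 1/f is - (1/f)^2 times that of f, so the induction feeds the lower regularity
    of 1/f itself back into the product rule. *)
Lemma CkV k U f : open U -> (forall x, U x -> f x != 0) -> Ck k U f ->
  Ck k U (fun x => (f x)^-1).
Proof.
move=> oU f0; elim: k => [|k IHk] Cf.
  by split=> // x Ux; apply: continuousV; [exact: f0|exact: Cf.1].
have [cf df] := Cf; split.
  by move=> x Ux; apply: continuousV; [exact: f0|exact: cf].
move=> v; have [dfv Cdf] := df v; split=> [x Ux|].
  by apply: derivableV; [exact: f0|exact: dfv].
have CV := IHk (CkW Cf).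
apply: eq_Ck oU _ (CkM oU (Ck_cst k (-1) oU) (CkM oU (CkM oU CV CV) Cdf)) => x Ux.
rewrite deriveV; [|exact: f0|exact: dfv].
by rewrite mulN1r scaleNr -invfM -expr2.
Qed.

End IteratedDerivatives.

(** * Derivatives in one variable and the mean value theorem *)

Section OneVariable.
Variable R : realType.
Implicit Types (f g : R -> R) (t : R).

Lemma is_derive1_near f g t df : (\near t, f t = g t) ->
  is_derive t 1 f df -> is_derive t 1 g df.
Proof. exact: near_eq_is_derive. Qed.

Lemma is_derive1_continuous f t df : is_derive t 1 f df ->
  {for t, continuous f}.
Proof.
by move=> [ft _]; exact/differentiable_continuous/derivable1_diffP.
Qed.

Lemma is_derive1_id t : is_derive t 1 (fun x : R => x) 1.
Proof. exact: is_derive_id. Qed.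

Lemma is_derive1_cst (c t : R) : is_derive t 1 (fun _ : R => c) 0.
Proof. exact: is_derive_cst. Qed.

Lemma is_derive1D f g t df dg : is_derive t 1 f df -> is_derive t 1 g dg ->
  is_derive t 1 (fun x => f x + g x) (df + dg).
Proof. exact: is_deriveD. Qed.

Lemma is_derive1N f t df : is_derive t 1 f df ->
  is_derive t 1 (fun x => - f x) (- df).
Proof. exact: is_deriveN. Qed.

Lemma is_derive1M f g t df dg : is_derive t 1 f df -> is_derive t 1 g dg ->
  is_derive t 1 (fun x => f x * g x) (df * g t + f t * dg).
Proof.
move=> hf hg; have := is_deriveM hf hg.
by rewrite addrC [g t *: df]mulrC.
Qed.

Lemma is_derive1V f t df : f t != 0 -> is_derive t 1 f df ->
  is_derive t 1 (fun x => (f x)^-1) (- df / f t ^+ 2).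
Proof.
move=> f0 [dft <-]; apply: DeriveDef; first exact: derivableV.
by rewrite deriveV// scaleNr mulNr mulrC.
Qed.

Lemma is_derive1X f t df n : is_derive t 1 f df ->
  is_derive t 1 (fun x => f x ^+ n) (n%:R * f t ^+ n.-1 * df).
Proof. by move=> hf; have := is_deriveX n hf; rewrite exprfctE. Qed.

(** Formulated through distances to [a], so that [a] and [b] come in no particular order and a small
    box supplies the hypothesis directly. *)
Lemma mean_value f (df : R -> R) (a b : R) :
  (forall x, `|x - a| <= `|b - a| -> is_derive x 1 f (df x)) ->
  exists2 c, `|c - a| <= `|b - a| & f b - f a = df c * (b - a).
Proof.
have main (a' b' : R) : a' <= b' ->
    (forall x : R, a' <= x <= b' -> is_derive x 1 f (df x)) ->
    exists2 c, a' <= c <= b' & f b' - f a' = df c * (b' - a').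
  move=> ab dfab; have [] := @MVT_segment _ f df a' b' ab.
  - by move=> x; rewrite in_itv/= => /andP[/ltW xa /ltW xb]; apply: dfab;
      rewrite xa xb.
  - apply: derivable_within_continuous => x; rewrite in_itv/= => /dfab[dfx _].
    exact: dfx.
  - by move=> c; rewrite in_itv/= => cab E; exists c.
move=> dfab; have [ab|/ltW ba] := leP a b.
  have [x /andP[ax xb]|c /andP[ac cb] E] := main _ _ ab.
    by apply: dfab; rewrite !ger0_norm ?subr_ge0// lerD2r.
  by exists c => //; rewrite !ger0_norm ?subr_ge0// lerD2r.
have [x /andP[bx xa]|c /andP[bc ca] E] := main _ _ ba.
  by apply: dfab; rewrite !ler0_norm ?subr_le0// !opprB lerD2l lerN2.
exists c; first by rewrite !ler0_norm ?subr_le0// !opprB lerD2l lerN2.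
by rewrite -opprB E -mulrN opprB.
Qed.

End OneVariable.

(** * Smooth functions of two variables *)

Section TwoVariables.
Variable R : realType.
Implicit Types (A : set (R * R)) (f g : R -> R -> R) (r s t : R).

Definition smooth2 A f : Prop :=
  open A /\ smooth_on A (fun p : R * R => f p.1 p.2).

Lemma eq_smooth2 A f g : (forall r s, A (r, s) -> f r s = g r s) ->
  smooth2 A f -> smooth2 A g.
Proof.
move=> fg [oA sf]; split=> // k; apply: eq_Ck oA _ (sf k).
by move=> [r s]; exact: fg.
Qed.

Lemma smooth2_subset A B f : open A -> A `<=` B -> smooth2 B f -> smooth2 A f.
Proof. by move=> oA AB [_ sf]; split=> // k; exact: Ck_subset (sf k). Qed.

Lemma smooth2_cst A (c : R) : open A -> smooth2 A (fun _ _ => c).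
Proof. by move=> oA; split=> // k; exact: Ck_cst. Qed.

Lemma smooth2_fst A : open A -> smooth2 A (fun r _ => r).
Proof.
move=> oA; split=> [//|k].
have cont (p : R * R) : A p -> {for p, continuous (fun p : R * R => p.1)}.
  by move=> _; exact: cvg_fst.
case: k => [|k]; split=> //.
have d1 (v p : R * R) : is_derive p v (fun p : R * R => p.1) v.1.
  suff c : (fun h => h^-1 *: ((h *: v + p).1 - p.1)) @ 0^' --> v.1.
    by split; [exact: (cvgP _ c)|apply: cvg_lim c].
  apply: (@cvg_trans _ ((fun=> v.1) @ 0^')); last exact: cvg_cst.
  apply: near_eq_cvg; near=> h.
  have h0 : h != 0 by near: h; exact: nbhs_dnbhs_neq.
  by rewrite /= addrK [RHS]mulrA mulVf ?mul1r.
move=> v; split=> [p _|]; first by have [] := d1 v p.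
by apply: (eq_Ck oA) (Ck_cst _ v.1 oA) => p _; rewrite (@derive_val _ _ _ _ _ _ _ (d1 v p)).
Unshelve. all: by end_near. Qed.

Lemma smooth2_snd A : open A -> smooth2 A (fun _ s => s).
Proof.
move=> oA; split=> [//|k].
have cont (p : R * R) : A p -> {for p, continuous (fun p : R * R => p.2)}.
  by move=> _; exact: cvg_snd.
case: k => [|k]; split=> //.
have d1 (v p : R * R) : is_derive p v (fun p : R * R => p.2) v.2.
  suff c : (fun h => h^-1 *: ((h *: v + p).2 - p.2)) @ 0^' --> v.2.
    by split; [exact: (cvgP _ c)|apply: cvg_lim c].
  apply: (@cvg_trans _ ((fun=> v.2) @ 0^')); last exact: cvg_cst.
  apply: near_eq_cvg; near=> h.
  have h0 : h != 0 by near: h; exact: nbhs_dnbhs_neq.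
  by rewrite /= addrK [RHS]mulrA mulVf ?mul1r.
move=> v; split=> [p _|]; first by have [] := d1 v p.
by apply: (eq_Ck oA) (Ck_cst _ v.2 oA) => p _; rewrite (@derive_val _ _ _ _ _ _ _ (d1 v p)).
Unshelve. all: by end_near. Qed.

Lemma smooth2D A f g : smooth2 A f -> smooth2 A g ->
  smooth2 A (fun r s => f r s + g r s).
Proof. by move=> [oA sf] [_ sg]; split=> // k; exact: CkD. Qed.

Lemma smooth2M A f g : smooth2 A f -> smooth2 A g ->
  smooth2 A (fun r s => f r s * g r s).
Proof. by move=> [oA sf] [_ sg]; split=> // k; exact: CkM. Qed.

Lemma smooth2N A f : smooth2 A f -> smooth2 A (fun r s => - f r s).
Proof.
move=> sf; have [oA _] := sf.
by apply: eq_smooth2 _ (smooth2M (smooth2_cst (-1) oA) sf) => r s _; rewrite mulN1r.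
Qed.

Lemma smooth2V A f : (forall r s, A (r, s) -> f r s != 0) -> smooth2 A f ->
  smooth2 A (fun r s => (f r s)^-1).
Proof.
move=> f0 [oA sf]; split=> // k; apply: CkV => //.
by move=> [r s]; exact: f0.
Qed.

Lemma smooth2X A f n : smooth2 A f -> smooth2 A (fun r s => f r s ^+ n).
Proof.
move=> sf; have [oA _] := sf; elim: n => [|n IHn].
  by apply: eq_smooth2 _ (smooth2_cst 1 oA) => r s _; rewrite expr0.
by apply: eq_smooth2 _ (smooth2M sf IHn) => r s _; rewrite exprS.
Qed.

Lemma d_rE f (p : R * R) :
  d_r f p.1 p.2 = 'D_((1, 0) : R * R) (fun p : R * R => f p.1 p.2) p.
Proof.
rewrite /d_r derive1E /derive.
set g1 := fun h => h^-1 *: _; set g2 := fun h => h^-1 *: _.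
suff -> : g1 = g2 by [].
by apply/funext => h; rewrite /g1 /g2 /= scaler0 add0r.
Qed.

Lemma d_sE f (p : R * R) :
  d_s f p.1 p.2 = 'D_((0, 1) : R * R) (fun p : R * R => f p.1 p.2) p.
Proof.
rewrite /d_s derive1E /derive.
set g1 := fun h => h^-1 *: _; set g2 := fun h => h^-1 *: _.
suff -> : g1 = g2 by [].
by apply/funext => h; rewrite /g1 /g2 /= scaler0 add0r.
Qed.

Lemma smooth2_d_r A f : smooth2 A f -> smooth2 A (d_r f).
Proof.
move=> [oA sf]; split=> // k; have [_ /(_ (1, 0)) [_]] := sf k.+1.
by apply: (eq_Ck oA) => p _; rewrite d_rE.
Qed.

Lemma smooth2_d_s A f : smooth2 A f -> smooth2 A (d_s f).
Proof.
move=> [oA sf]; split=> // k; have [_ /(_ (0, 1)) [_]] := sf k.+1.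
by apply: (eq_Ck oA) => p _; rewrite d_sE.
Qed.

Lemma is_derive_d_r A f r s : smooth2 A f -> A (r, s) ->
  is_derive r 1 (fun t => f t s) (d_r f r s).
Proof.
move=> [oA sf] Ars; rewrite /d_r derive1E; apply: derivableP.
have [_ /(_ (1, 0)) [/(_ _ Ars) /derivable1P + _]] := sf 1%N.
move=> h; apply/derivable1P; move: h.
set g1 := fun h : R => _; set g2 := fun h : R => _.
suff -> : g1 = g2 by [].
by apply/funext => h; rewrite /g1 /g2 /= scaler0 add0r.
Qed.

Lemma is_derive_d_s A f r s : smooth2 A f -> A (r, s) ->
  is_derive s 1 (f r) (d_s f r s).
Proof.
move=> [oA sf] Ars; rewrite /d_s derive1E; apply: derivableP.
have [_ /(_ (0, 1)) [/(_ _ Ars) /derivable1P + _]] := sf 1%N.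
move=> h; apply/derivable1P; move: h.
set g1 := fun h : R => _; set g2 := fun h : R => _.
suff -> : g1 = g2 by [].
by apply/funext => h; rewrite /g1 /g2 /= scaler0 add0r.
Qed.

Lemma open_box A r s : open A -> A (r, s) ->
  exists2 e : R, 0 < e &
    forall a b, `|a - r| < e -> `|b - s| < e -> A (a, b).
Proof.
move=> oA Ars; have /nbhs_ballP[e /= e0 eA] := open_nbhs_nbhs (conj oA Ars).
exists e => // a b ha hb; apply: eA; split=> /=; by rewrite -ball_normE/= distrC.
Qed.

Lemma smooth2_box A f r s e : smooth2 A f -> A (r, s) -> 0 < e ->
  exists2 d : R, 0 < d & forall a b, `|a - r| < d -> `|b - s| < d ->
    A (a, b) /\ `|f a b - f r s| < e.
Proof.
move=> [oA sf] Ars e0; have /cvgrPdist_lt/(_ e e0) := Ck_continuous (sf 0%N) Ars.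
move=> /nbhs_ballP[d1 /= d10 hd1]; have [d2 d20 hd2] := open_box oA Ars.
exists (Num.min d1 d2) => [|a b]; first by rewrite lt_min d10.
rewrite !lt_min => /andP[a1 a2] /andP[b1 b2]; split; first exact: hd2.
rewrite distrC; apply: (hd1 (a, b)).
by split; rewrite -ball_normE/= distrC.
Qed.

Lemma cvg_smooth2 (T : Type) (F : set_system T) {FF : Filter F} A f
    (a b : T -> R) r s : smooth2 A f -> A (r, s) ->
  a @ F --> r -> b @ F --> s -> (fun x => f (a x) (b x)) @ F --> f r s.
Proof.
move=> sf Ars ca cb; apply/cvgrPdist_lt => e e0.
have [d d0 hd] := smooth2_box sf Ars e0.
move/cvgrPdist_lt/(_ d d0) : ca => ca; move/cvgrPdist_lt/(_ d d0) : cb => cb.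
near=> x; rewrite distrC; apply: (hd _ _ _ _).2.
  by rewrite distrC; near: x.
by rewrite distrC; near: x.
Unshelve. all: by end_near. Qed.

(** Only partial derivatives are at hand. The increment splits into one in the second argument with
    the first frozen at [a t], where the one-variable chain rule applies, and one in the first
    argument, where the mean value theorem and the continuity of [d_r f] give the limit. *)
Lemma is_derive_smooth2_comp A f (a b : R -> R) t da db :
  smooth2 A f -> A (a t, b t) -> is_derive t 1 a da -> is_derive t 1 b db ->
  is_derive t 1 (fun x => f (a x) (b x))
    (d_r f (a t) (b t) * da + d_s f (a t) (b t) * db).
Proof.
move=> sf Aab ha hb.
have hs : is_derive t 1 (fun x => f (a t) (b x)) (d_s f (a t) (b t) * db).
  exact: (@is_derive1_comp _ (f (a t)) b _ _ _ (is_derive_d_s sf Aab) hb).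
suff hr : is_derive t 1 (fun x => f (a x) (b x) - f (a t) (b x))
    (d_r f (a t) (b t) * da).
  have := is_derive1D hr hs; congr is_derive.
  by apply/funext => x; rewrite subrK.
have [oA _] := sf; have [e e0 he] := open_box oA Aab.
have cvg_at (c : R -> R) dc : is_derive t 1 c dc ->
    (fun h => c (h *: 1 + t)) @ 0^' --> c t.
  move=> hc; have : (fun h : R => h *: 1 + t) @ 0^' --> t.
    rewrite -[X in _ --> X]add0r; apply: cvgD; last exact: cvg_cst.
    rewrite (_ : (fun _ => _) = id); first exact: cvg_within.
    by apply/funext => h; rewrite [LHS]mulr1.
  move=> ct; exact: (cvg_comp _ _ ct (is_derive1_continuous hc)).
have ca := cvg_at _ _ ha; have cb := cvg_at _ _ hb.
have near_box : \forall h \near 0^', `|a (h *: 1 + t) - a t| < e /\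
    `|b (h *: 1 + t) - b t| < e.
  move/cvgrPdist_lt/(_ e e0) : ca => ca; move/cvgrPdist_lt/(_ e e0) : cb => cb.
  by near=> h; split; rewrite distrC; near: h.
(* [xi h] is the mean value point for the increment [h], chosen as a function so that its limit can
   be taken. Outside the box nothing is required of it and 0 serves. *)
have /choice[xi hxi] (h : R) : exists c : R,
    `|a (h *: 1 + t) - a t| < e -> `|b (h *: 1 + t) - b t| < e ->
    `|c - a t| <= `|a (h *: 1 + t) - a t| /\
    f (a (h *: 1 + t)) (b (h *: 1 + t)) - f (a t) (b (h *: 1 + t)) =
    d_r f c (b (h *: 1 + t)) * (a (h *: 1 + t) - a t).
  have [hae|] := pselect (`|a (h *: 1 + t) - a t| < e); last by exists 0.
  have [hbe|] := pselect (`|b (h *: 1 + t) - b t| < e); last by exists 0.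
  have [|c hc E] := @mean_value _ (fun x => f x (b (h *: 1 + t)))
      (fun x => d_r f x (b (h *: 1 + t))) (a t) (a (h *: 1 + t)).
    move=> x hx; apply: is_derive_d_r sf _; apply: he => //.
    exact: le_lt_trans hx hae.
  by exists c.
have cxi : xi @ 0^' --> a t.
  apply/cvgrPdist_lt => eps eps0; move/cvgrPdist_lt/(_ eps eps0) : ca => ca.
  near=> h; have [hae hbe] : `|a (h *: 1 + t) - a t| < e /\
    `|b (h *: 1 + t) - b t| < e by near: h.
  have [+ _] := hxi h hae hbe; rewrite distrC => /le_lt_trans; apply.
  by rewrite distrC; near: h.
have cdr : (fun h : R => d_r f (xi h) (b (h *: 1 + t))) @ 0^' -->
    d_r f (a t) (b t) by exact: cvg_smooth2 (smooth2_d_r sf) Aab cxi cb.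
have cda : (fun h : R => h^-1 *: (a (h *: 1 + t) - a t)) @ 0^' --> da.
  by have [da1 <-] := ha; exact: da1.
have cprod : (fun h : R => d_r f (xi h) (b (h *: 1 + t)) *
    (h^-1 *: (a (h *: 1 + t) - a t))) @ 0^' --> d_r f (a t) (b t) * da.
  exact: cvgM cdr cda.
have cq : (fun h : R => h^-1 *: ((fun x => f (a x) (b x) - f (a t) (b x)) (h *: 1 + t)
     - (fun x => f (a x) (b x) - f (a t) (b x)) t)) @ 0^' -->
    d_r f (a t) (b t) * da.
  apply: cvg_trans cprod; apply: near_eq_cvg; near=> h.
  have [hae hbe] : `|a (h *: 1 + t) - a t| < e /\
    `|b (h *: 1 + t) - b t| < e by near: h.
  have [_ E] := hxi h hae hbe.
  by rewrite /= subrr subr0 E /= /GRing.scale/= mulrCA.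
by split; [exact: (cvgP _ cq)|apply: cvg_lim cq].
Unshelve. all: by end_near. Qed.

(** The double difference f(r+h,s+h) - f(r+h,s) - f(r,s+h) + f(r,s), evaluated by two mean values in
    either order, is h^2 times each of the mixed derivatives at some point of the box. *)
Lemma mixed_difference (f fr fs frs fsr : R -> R -> R) r s (h : R) : h != 0 ->
  (forall a b : R, `|a - r| <= `|h| -> `|b - s| <= `|h| ->
    [/\ is_derive a 1 (fun x => f x b) (fr a b), is_derive b 1 (f a) (fs a b),
        is_derive b 1 (fr a) (frs a b) &
        is_derive a 1 (fun x => fs x b) (fsr a b)]) ->
  exists a b c d : R, [/\ `|a - r| <= `|h|, `|b - s| <= `|h|, `|c - r| <= `|h|,
    `|d - s| <= `|h| & frs a b = fsr c d].
Proof.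
move=> h0 df; have addK (c : R) : c + h - c = h by rewrite [c + h]addrC addrK.
have bh (c : R) : `|c + h - c| <= `|h| by rewrite addK.
have b0 (c : R) : `|c - c| <= `|h| by rewrite subrr normr0.
have [|a ha E1] := @mean_value _ (fun a => f a (s + h) - f a s)
    (fun a => fr a (s + h) - fr a s) r (r + h).
  move=> a; rewrite addK => ha; apply: is_derive1D; last apply: is_derive1N.
    by have [] := df a (s + h) ha (bh s).
  by have [] := df a s ha (b0 s).
rewrite addK in ha; have [|b hb E2] := @mean_value _ (fr a) (frs a) s (s + h).
  by move=> b; rewrite addK => hb; have [] := df a b ha hb.
have [|d hd E3] := @mean_value _ (fun b => f (r + h) b - f r b)
    (fun b => fs (r + h) b - fs r b) s (s + h).
  move=> b'; rewrite addK => hb'; apply: is_derive1D; last apply: is_derive1N.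
    by have [] := df (r + h) b' (bh r) hb'.
  by have [] := df r b' (b0 r) hb'.
rewrite addK in hd; have [|c hc E4] := @mean_value _ (fun a => fs a d) (fun a => fsr a d) r (r + h).
  by move=> c; rewrite addK => hc; have [] := df c d hc hd.
rewrite !addK in hb hc E1 E2 E3 E4.
exists a, b, c, d; split=> //; apply: (mulIf h0); apply: (mulIf h0).
by rewrite -E2 -E1 -E4 -E3 opprD addrACA -opprD.
Qed.

Lemma dist_lt_double (x y x' y' e : R) : `|x' - x| < e -> `|y' - y| < e ->
  x' = y' -> `|x - y| < e + e.
Proof.
move=> hx hy E; apply: le_lt_trans (ltrD hx hy).
by rewrite (distrC x') E; exact: ler_distD.
Qed.

(** If the mixed derivatives differed by 2e at (r, s), a box on which both stay within e of their
    values there would contradict [mixed_difference]. *)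
Lemma d_s_d_r A f r s : smooth2 A f -> A (r, s) ->
  d_s (d_r f) r s = d_r (d_s f) r s.
Proof.
move=> sf Ars; apply/eqP; rewrite -subr_eq0; apply: contraT; rewrite -normr_gt0 => m0.
have [e e0 Ee] : exists2 e : R,
    0 < e & `|d_s (d_r f) r s - d_r (d_s f) r s| = e + e.
  by exists (`|d_s (d_r f) r s - d_r (d_s f) r s| / 2);
    [rewrite divr_gt0|exact: splitr].
have [d1 d10 h1] := smooth2_box (smooth2_d_s (smooth2_d_r sf)) Ars e0.
have [d2 d20 h2] := smooth2_box (smooth2_d_r (smooth2_d_s sf)) Ars e0.
have [h h0 [hd1 hd2]] : exists2 h : R, 0 < h & h < d1 /\ h < d2.
  have min0 : 0 < Num.min d1 d2 by rewrite lt_min d10.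
  exists (Num.min d1 d2 / 2); first by rewrite divr_gt0.
  by apply/andP; rewrite -lt_min ltr_pdivrMr// mulr_natr mulr2n ltrDl.
have hn0 : h != 0 by rewrite gt_eqF.
have small (x : R) : `|x| <= `|h| -> `|x| < d1 /\ `|x| < d2.
  by rewrite (gtr0_norm h0) => xh; rewrite !(le_lt_trans xh).
have [|a [b [c [d [/small[a1 _] /small[b1 _] /small[_ c2] /small[_ dd2] E]]]]] :=
    @mixed_difference f (d_r f) (d_s f) (d_s (d_r f)) (d_r (d_s f)) r s h hn0.
  move=> a b /small[ha _] /small[hb _]; have [Aab _] := h1 a b ha hb.
  split; [exact: is_derive_d_r sf Aab|exact: is_derive_d_s sf Aab|
    exact: is_derive_d_s (smooth2_d_r sf) Aab|
    exact: is_derive_d_r (smooth2_d_s sf) Aab].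
have [_ l1] := h1 a b a1 b1; have [_ l2] := h2 c d c2 dd2.
suff : e + e < e + e by rewrite ltxx.
by rewrite -[X in X < _]Ee; exact: dist_lt_double l1 l2 E.
Qed.

End TwoVariables.

(** * The relation between the curvature coefficients *)

(** Meant for goals whose derivative is an existential variable: the derivative is read off the
    expression and compared with the expected one afterwards. Constants are matched before anything
    else. *)
Ltac is_derive1_step :=
  match goal with
  | |- is_derive _ _ (fun _ => ?c) _ => exact: (@is_derive1_cst _ c)
  | |- is_derive _ _ (fun x => x) _ => exact: is_derive1_id
  | |- is_derive _ _ (fun x => @?f x + @?g x) _ => eapply (@is_derive1D _ f g)
  | |- is_derive _ _ (fun x => @?f x * @?g x) _ => eapply (@is_derive1M _ f g)
  | |- is_derive _ _ (fun x => - @?f x) _ => eapply (@is_derive1N _ f)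
  | |- is_derive _ _ (fun x => @?f x ^+ ?n) _ => eapply (@is_derive1X _ f _ _ n)
  | |- is_derive _ _ (fun x => (@?f x)^-1) _ => eapply (@is_derive1V _ f)
  end.

Section CurvatureRelation.
Variable R : realType.

(** An identity on an open set may be differentiated in s; [a] and [b] are the derivatives computed
    from its two sides. *)
Lemma eq_is_derive_s (A : set (R * R)) (f g : R -> R -> R) r s a b :
  open A -> (forall r s, A (r, s) -> f r s = g r s) -> A (r, s) ->
  is_derive s 1 (f r) a -> is_derive s 1 (g r) b -> a = b.
Proof.
move=> oA fg Ars hf hg; have [e e0 he] := open_box oA Ars.
have hg' : is_derive s 1 (g r) a.
  apply: is_derive1_near hf; near=> x; apply: fg; apply: he.
    by rewrite subrr normr0.
  by near: x; apply/nbhs_ballP; exists e => //= x; rewrite -ball_normE/= distrC.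
by have [_ <-] := hg'; have [_ <-] := hg.
Unshelve. all: by end_near. Qed.

Lemma eq_is_derive_r (A : set (R * R)) (f g : R -> R -> R) r s a b :
  open A -> (forall r s, A (r, s) -> f r s = g r s) -> A (r, s) ->
  is_derive r 1 (fun x => f x s) a -> is_derive r 1 (fun x => g x s) b -> a = b.
Proof.
move=> oA fg Ars hf hg; have [e e0 he] := open_box oA Ars.
have hg' : is_derive r 1 (fun x => g x s) a.
  apply: is_derive1_near hf; near=> x; apply: fg; apply: he; last first.
    by rewrite subrr normr0.
  by near: x; apply/nbhs_ballP; exists e => //= x; rewrite -ball_normE/= distrC.
by have [_ <-] := hg'; have [_ <-] := hg.
Unshelve. all: by end_near. Qed.

(* [E1] says that the spray annihilates F and [E2], which follows from [E0] and
   the s-derivative of [E1], that the connection does; the last three are the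
   remaining first derivatives of [E2] and [E1]. *)
Lemma curvature_relation_alg (K : fieldType)
    (r s f fr fs frr frs fss P Pr Ps Prs Pss Q Qr Qs Qrs Qss : K) :
  let a := r ^+ 2 - s ^+ 2 in
  let W := s * f + a * fs in
  let D := f - s * fs + a * fss in
  r != 0 ->
  2 * Q * D = (- fr + s * frs + r * fss) / r ->
  2 * P * f + 2 * Q * W = s / r * fr + fs ->
  Ps * f + P * fs + Qs * W = fr / r ->
  Pss * f + 2 * Ps * fs + P * fss + Qss * W + Qs * D = frs / r ->
  Prs * f + Ps * fr + Pr * fs + P * frs + Qrs * W
    + Qs * (s * fr + 2 * r * fs + a * frs) = frr / r - fr / r ^+ 2 ->
  2 * Pr * f + 2 * P * fr + 2 * Qr * W + 2 * Q * (s * fr + 2 * r * fs + a * frs)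
    = s / r * frr - s / r ^+ 2 * fr + frs ->
  f * (2 / r * Pr - s / r * Prs - Pss - Qs + 2 * P * Q - 2 * s * Ps * Q
       + 2 * a * Pss * Q - P * Ps - s * P * Qs - a * Ps * Qs) =
  - fs * (2 * Q - s / r * Pr - Ps + 2 * a * Ps * Q + P ^+ 2 + 2 * s * P * Q)
  - W * (2 / r * Qr - Qss - s / r * Qrs + 2 * a * Q * Qss + 4 * Q ^+ 2
         - a * Qs ^+ 2 - 2 * s * Q * Qs).
Proof.
move=> a W D r0 E0 E1 E2 E2s E2r E1r.
apply/eqP; rewrite -subr_eq0; apply/eqP.
pose z0 := (- fr + s * frs + r * fss) / r - 2 * Q * D.
pose z1 := 2 * P * f + 2 * Q * W - (s / r * fr + fs).
pose z2 := Ps * f + P * fs + Qs * W - fr / r.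
pose z2s := Pss * f + 2 * Ps * fs + P * fss + Qss * W + Qs * D - frs / r.
pose z2r := Prs * f + Ps * fr + Pr * fs + P * frs + Qrs * W
    + Qs * (s * fr + 2 * r * fs + a * frs) - (frr / r - fr / r ^+ 2).
pose z1r := 2 * Pr * f + 2 * P * fr + 2 * Qr * W
    + 2 * Q * (s * fr + 2 * r * fs + a * frs)
    - (s / r * frr - s / r ^+ 2 * fr + frs).
(* On functions of (r, s) the spray acts as u times (s / r) d/dr + (1 - 2 a Q) d/ds. The
   differentiated equations thus enter as the x-derivative of [E1] minus the spray derivative of
   [E2], and the other coefficients cancel what remains. *)
transitivity (z1r / r - s / r * z2r - (1 - 2 * a * Q) * z2s + (P - a * Qs) * z2
  - (Ps + s * Qs - 2 * Q) * z1 + (a * Qs + P) * z0); last first.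
  rewrite /z1r /z2r /z2s /z2 /z1 /z0 E0 E1 E2 E2s E2r E1r !subrr.
  by rewrite mul0r !mulr0 !subr0 !addr0.
by rewrite /z1r /z2r /z2s /z2 /z1 /z0 /D /W /a; field.
Qed.

Section Jets.
Variables (A : set (R * R)).
Variables (f fr fs frr frs fss P Pr Ps Prs Pss Q Qr Qs Qrs Qss : R -> R -> R).

Let is_dr (g gr : R -> R -> R) :=
  forall r s, A (r, s) -> is_derive r 1 (fun x => g x s) (gr r s).
Let is_ds (g gs : R -> R -> R) :=
  forall r s, A (r, s) -> is_derive s 1 (g r) (gs r s).

(** One function [frs] is both the s-derivative of [fr] and the r-derivative of [fs]: this is how
    the symmetry of second derivatives enters. *)
Lemma curvature_relation_jets :
  open A -> (forall r s, A (r, s) -> r != 0) ->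
  is_dr f fr -> is_ds f fs -> is_dr fr frr -> is_ds fr frs -> is_dr fs frs ->
  is_ds fs fss -> is_dr P Pr -> is_ds P Ps -> is_dr Ps Prs -> is_ds Ps Pss ->
  is_dr Q Qr -> is_ds Q Qs -> is_dr Qs Qrs -> is_ds Qs Qss ->
  (forall r s, A (r, s) ->
    2 * Q r s * (f r s - s * fs r s + (r ^+ 2 - s ^+ 2) * fss r s) =
    (- fr r s + s * frs r s + r * fss r s) / r) ->
  (forall r s, A (r, s) ->
    2 * P r s * f r s + 2 * Q r s * (s * f r s + (r ^+ 2 - s ^+ 2) * fs r s) =
    s / r * fr r s + fs r s) ->
  forall r s, A (r, s) -> let a := r ^+ 2 - s ^+ 2 in
  f r s * (2 / r * Pr r s - s / r * Prs r s - Pss r s - Qs r s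
    + 2 * P r s * Q r s - 2 * s * Ps r s * Q r s + 2 * a * Pss r s * Q r s
    - P r s * Ps r s - s * P r s * Qs r s - a * Ps r s * Qs r s) =
  - fs r s * (2 * Q r s - s / r * Pr r s - Ps r s + 2 * a * Ps r s * Q r s
    + P r s ^+ 2 + 2 * s * P r s * Q r s)
  - (s * f r s + a * fs r s) * (2 / r * Qr r s - Qss r s - s / r * Qrs r s
    + 2 * a * Q r s * Qss r s + 4 * Q r s ^+ 2 - a * Qs r s ^+ 2
    - 2 * s * Q r s * Qs r s).
Proof.
move=> oA rA hfr hfs hfrr hfrs hfsr hfss hPr hPs hPsr hPss hQr hQs hQsr hQss E0 E1.
(* The s-derivative of s f + (r^2 - s^2) f_s is the denominator of Q, so [E0] eliminates Q from the
   s-derivative of [E1], and twice the claim is left. *)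
have E2 r s : A (r, s) ->
    Ps r s * f r s + P r s * fs r s
    + Qs r s * (s * f r s + (r ^+ 2 - s ^+ 2) * fs r s) = fr r s / r.
  move=> Ars; have r0 := rA _ _ Ars.
  have := eq_is_derive_s oA E1 Ars; have := E0 _ _ Ars.
  have := hPs _ _ Ars; have := hQs _ _ Ars; have := hfs _ _ Ars.
  have := hfrs _ _ Ars; have := hfss _ _ Ars.
  move=> dfss dfrs dfs dQs dPs e0 E.
  have {E} := E _ _ ltac:(repeat first [is_derive1_step|eassumption])
    ltac:(repeat first [is_derive1_step|eassumption]).
  move: e0 => /eqP; rewrite -subr_eq0 => /eqP e0 /eqP; rewrite -subr_eq0 => /eqP e1.
  apply/eqP; rewrite -subr_eq0; apply/eqP.
  apply: (mulfI (_ : (2 : R) != 0)); first by rewrite pnatr_eq0.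
  rewrite mulr0 -[RHS]e1 -[LHS]addr0 -[X in _ + X = _]e0.
  by field.
move=> r s Ars a; have r0 := rA _ _ Ars.
have dP_r := hPr _ _ Ars; have dP_s := hPs _ _ Ars.
have dPs_r := hPsr _ _ Ars; have dPs_s := hPss _ _ Ars.
have dQ_r := hQr _ _ Ars; have dQ_s := hQs _ _ Ars.
have dQs_r := hQsr _ _ Ars; have dQs_s := hQss _ _ Ars.
have df_r := hfr _ _ Ars; have df_s := hfs _ _ Ars.
have dfr_r := hfrr _ _ Ars; have dfr_s := hfrs _ _ Ars.
have dfs_r := hfsr _ _ Ars; have dfs_s := hfss _ _ Ars.
apply: (@curvature_relation_alg _ r s (f r s) (fr r s) (fs r s) (frr r s)
  (frs r s) (fss r s)) => //; first exact: E0.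
- exact: E1.
- exact: E2.
- have E := eq_is_derive_s oA E2 Ars.
  have {E} := E _ _
    ltac:(repeat first [is_derive1_step|eassumption])
    ltac:(repeat first [is_derive1_step|eassumption]).
  move=> /eqP; rewrite -subr_eq0 => /eqP e.
  by apply/eqP; rewrite -subr_eq0 -e; apply/eqP; field.
- have E := eq_is_derive_r oA E2 Ars.
  have {E} := E _ _
    ltac:(repeat first [is_derive1_step|eassumption|exact: r0])
    ltac:(repeat first [is_derive1_step|eassumption|exact: r0]).
  move=> /eqP; rewrite -subr_eq0 => /eqP e.
  by apply/eqP; rewrite -subr_eq0 -e; apply/eqP; field.
- have E := eq_is_derive_r oA E1 Ars.
  have {E} := E _ _
    ltac:(repeat first [is_derive1_step|eassumption|exact: r0])
    ltac:(repeat first [is_derive1_step|eassumption|exact: r0]).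
  move=> /eqP; rewrite -subr_eq0 => /eqP e.
  by apply/eqP; rewrite -subr_eq0 -e; apply/eqP; field.
Qed.

End Jets.
End CurvatureRelation.

(** * Derivatives along lines *)

Section Dotp.
Variables (R : realType) (n : nat).
Implicit Types (x y z a b : 'rV[R]_n) (t : R).

Lemma dotpC x y : dotp x y = dotp y x.
Proof. by apply: eq_bigr => i _; rewrite mulrC. Qed.

Lemma dotpDl x y z : dotp (x + y) z = dotp x z + dotp y z.
Proof. by rewrite -big_split; apply: eq_bigr => i _; rewrite mxE mulrDl. Qed.

Lemma dotpDr x y z : dotp z (x + y) = dotp z x + dotp z y.
Proof. by rewrite dotpC dotpDl !(dotpC z). Qed.

Lemma dotpZl t x y : dotp (t *: x) y = t * dotp x y.
Proof. by rewrite mulr_sumr; apply: eq_bigr => i _; rewrite mxE mulrA. Qed.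

Lemma dotpZr t x y : dotp x (t *: y) = t * dotp x y.
Proof. by rewrite dotpC dotpZl dotpC. Qed.

Lemma dotp0l x : dotp 0 x = 0.
Proof. by apply: big1 => i _; rewrite mxE mul0r. Qed.

Lemma dotp0r x : dotp x 0 = 0.
Proof. by rewrite dotpC dotp0l. Qed.

Lemma dotp_delta x (k : 'I_n) : dotp x (delta_mx ord0 k) = x ord0 k.
Proof.
rewrite /dotp (bigD1 k)//= mxE !eqxx mulr1 big1 ?addr0// => i /negbTE ik.
by rewrite mxE eqxx ik mulr0.
Qed.

Lemma dotp_ge0 x : 0 <= dotp x x.
Proof. by apply: sumr_ge0 => i _; rewrite -expr2 sqr_ge0. Qed.

Lemma dotp_eq0 x : (dotp x x == 0) = (x == 0).
Proof.
apply/eqP/eqP => [/eqP|->]; last exact: dotp0l.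
rewrite psumr_eq0 => [|i _]; last by rewrite -expr2 sqr_ge0.
move=> /allP x0; apply/rowP => i; rewrite mxE; apply/eqP.
by have /implyP/(_ isT) := x0 i (mem_index_enum i); rewrite mulf_eq0 orbb.
Qed.

Lemma dotp_gt0 x : (0 < dotp x x) = (x != 0).
Proof. by rewrite lt_neqAle dotp_ge0 andbT eq_sym dotp_eq0. Qed.

Lemma enorm_sqr x : enorm x ^+ 2 = dotp x x.
Proof. by rewrite sqr_sqrtr// dotp_ge0. Qed.

Lemma enorm_neq0 x : (enorm x != 0) = (x != 0).
Proof. by rewrite sqrtr_eq0 -ltNge dotp_gt0. Qed.

Lemma dotp_rs_s x y : y != 0 -> dotp x y = rs_s x y * enorm y.
Proof. by move=> y0; rewrite /rs_s divfK// enorm_neq0. Qed.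

Lemma is_derive_line x a t (i : 'I_n) :
  is_derive t 1 (fun t => (t *: a + x) ord0 i) (a ord0 i).
Proof.
rewrite (_ : (fun _ => _) = (fun t => t * a ord0 i + x ord0 i)); last first.
  by apply/funext => z; rewrite !mxE.
eapply is_derive_eq; first by repeat is_derive1_step.
by rewrite mul1r mulr0 !addr0.
Qed.

Lemma is_derive_dotp x y a b :
  is_derive (0 : R) 1 (fun t => dotp (t *: a + x) (t *: b + y))
    (dotp y a + dotp x b).
Proof.
rewrite (_ : (fun _ => _) = (fun t => t ^+ 2 * dotp a b
    + t * (dotp y a + dotp x b) + dotp x y)); last first.
  apply/funext => t; rewrite !(dotpDl, dotpDr, dotpZl, dotpZr) (dotpC a y).
  by ring.
eapply is_derive_eq; first by repeat is_derive1_step.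
by rewrite /=; ring.
Qed.

Lemma is_derive_enorm x a : x != 0 ->
  is_derive (0 : R) 1 (fun t => enorm (t *: a + x)) (dotp x a / enorm x).
Proof.
move=> x0; have d0 := is_derive_dotp x x a a.
have xx : 0 < dotp (0 *: a + x) (0 *: a + x).
  by rewrite scale0r add0r dotp_gt0.
have h := @is_derive1_comp _ Num.sqrt _ 0 _ _ (is_derive1_sqrt xx) d0.
apply: is_derive_eq h _.
rewrite scale0r add0r -/(enorm x).
by have := enorm_neq0 x; rewrite x0 => u0; field.
Qed.

Lemma is_derive_rs_s x y a b : y != 0 ->
  is_derive (0 : R) 1 (fun t => rs_s (t *: a + x) (t *: b + y))
   ((dotp y a + dotp x b) / enorm y - rs_s x y * dotp y b / enorm y ^+ 2).
Proof.
move=> y0; have u0 : enorm y != 0 by rewrite enorm_neq0.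
have d1 := is_derive_dotp x y a b; have d2 := is_derive_enorm b y0.
eapply is_derive_eq.
  eapply (@is_derive1M _ _ (fun t => (enorm (t *: b + y))^-1)); first exact: d1.
  by eapply is_derive1V; [rewrite scale0r add0r|exact: d2].
rewrite !scale0r !add0r /rs_s.
by field.
Qed.

(** The other argument moves with velocity 0 instead of being fixed, so that the same derivatives
    along lines serve both kinds of partial derivative. *)
Lemma partial_xE (H : 'rV[R]_n -> 'rV[R]_n -> R) x y (k : 'I_n) l :
  is_derive (0 : R) 1
    (fun t => H (t *: delta_mx ord0 k + x) (t *: 0 + y)) l ->
  partial_x k H x y = l.
Proof.
move=> [_ <-]; rewrite /partial_x /derive.
set g1 := fun h => h^-1 *: _; set g2 := fun h => h^-1 *: _.
suff -> : g1 = g2 by [].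
apply/funext => h; rewrite /g1 /g2 /=.
by rewrite !scaler0 !add0r scale0r add0r [_%:A]mulr1 addr0.
Qed.

Lemma partial_yE (H : 'rV[R]_n -> 'rV[R]_n -> R) x y (k : 'I_n) l :
  is_derive (0 : R) 1
    (fun t => H (t *: 0 + x) (t *: delta_mx ord0 k + y)) l ->
  partial_y k H x y = l.
Proof.
move=> [_ <-]; rewrite /partial_y /derive.
set g1 := fun h => h^-1 *: _; set g2 := fun h => h^-1 *: _.
suff -> : g1 = g2 by [].
apply/funext => h; rewrite /g1 /g2 /=.
by rewrite !scaler0 !add0r scale0r add0r [_%:A]mulr1 addr0.
Qed.

End Dotp.

(** * The Riemann curvature of a spherically symmetric spray *)

(** [spray_G] with P and Q abstract: the curvature computation uses no formula for them. *)
Definition spherical_spray (R : realType) (n : nat) (P Q : R -> R -> R) (i : 'I_n)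
    (x y : 'rV[R]_n) : R :=
  enorm y * P (enorm x) (rs_s x y) * y ord0 i +
  enorm y ^+ 2 * Q (enorm x) (rs_s x y) * x ord0 i.

Section RiemannCurvature.
Variables (R : realType) (n : nat) (A : set (R * R)).
Hypothesis oA : open A.

(** The chain rule along curves, taken as the meaning of having partial derivatives [fr] and [fs] on
    [A]; it is all that the curvature computation asks of P and Q. *)
Definition jet (f fr fs : R -> R -> R) :=
  forall (a b : R -> R) t da db, A (a t, b t) ->
    is_derive t 1 a da -> is_derive t 1 b db ->
    is_derive t 1 (fun x => f (a x) (b x))
      (fr (a t) (b t) * da + fs (a t) (b t) * db).

Definition regular_at (x y : 'rV[R]_n) : Prop :=
  [/\ x != 0, y != 0 & A (enorm x, rs_s x y)].

(** Lets identities that hold at all regular points be differentiated along lines. *)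
Lemma near_regular_at x y a b : regular_at x y ->
  \forall t \near (0 : R), regular_at (t *: a + x) (t *: b + y).
Proof.
move=> [x0 y0 Axy].
have /= := is_derive1_continuous (is_derive_enorm a x0).
have /= := is_derive1_continuous (is_derive_enorm b y0).
have /= := is_derive1_continuous (is_derive_rs_s x a b y0).
rewrite /prop_for /continuous_at !scale0r !add0r => cs cy cx.
have [e e0 he] := open_box oA Axy.
have x0' : enorm x != 0 by rewrite enorm_neq0.
have y0' : enorm y != 0 by rewrite enorm_neq0.
have nx : \forall t \near (0 : R), enorm (t *: a + x) != 0.
  exact: cvgr_neq0 cx x0'.
have ny : \forall t \near (0 : R), enorm (t *: b + y) != 0.
  exact: cvgr_neq0 cy y0'.
move/cvgrPdist_lt/(_ e e0) : cs => cs; move/cvgrPdist_lt/(_ e e0) : cx => cx.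
near=> t; split.
- by rewrite -enorm_neq0; near: t.
- by rewrite -enorm_neq0; near: t.
- by apply: he; rewrite distrC; near: t.
Unshelve. all: by end_near. Qed.

Lemma jet_line f fr fs x y a b : jet f fr fs -> regular_at x y ->
  is_derive (0 : R) 1
    (fun t => f (enorm (t *: a + x)) (rs_s (t *: a + x) (t *: b + y)))
    (fr (enorm x) (rs_s x y) * (dotp x a / enorm x) +
     fs (enorm x) (rs_s x y) * ((dotp y a + dotp x b) / enorm y
                                - rs_s x y * dotp y b / enorm y ^+ 2)).
Proof.
move=> jf [x0 y0 Axy].
have := @jf (fun t => enorm (t *: a + x))
  (fun t => rs_s (t *: a + x) (t *: b + y)) 0 _ _ _
  (is_derive_enorm a x0) (is_derive_rs_s x a b y0).
by rewrite /= !scale0r !add0r; apply.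
Qed.

Variables P Pr Ps Prs Pss Q Qr Qs Qrs Qss : R -> R -> R.
Hypotheses (jP : jet P Pr Ps) (jPs : jet Ps Prs Pss).
Hypotheses (jQ : jet Q Qr Qs) (jQs : jet Qs Qrs Qss).

Local Notation G := (spherical_spray P Q).

(** The derivative of G^i in a direction (a, b), reduced to scalars: [xa], [ya], [xb], [yb] are
    inner products and [ai], [bi] components of the direction. *)
Definition dG_alg (r s u p pr ps q qr qs xi yi xa ya xb yb ai bi : R) : R :=
  let ds := (ya + xb) / u - s * yb / u ^+ 2 in
  let dp := pr * (xa / r) + ps * ds in
  let dq := qr * (xa / r) + qs * ds in
  yb / u * p * yi + u * dp * yi + u * p * bi
  + 2 * yb * q * xi + u ^+ 2 * dq * xi + u ^+ 2 * q * ai.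

Lemma is_derive_G i x y a b : regular_at x y ->
  is_derive (0 : R) 1 (fun t => G i (t *: a + x) (t *: b + y))
    (let r := enorm x in let s := rs_s x y in
     dG_alg r s (enorm y) (P r s) (Pr r s) (Ps r s) (Q r s) (Qr r s) (Qs r s)
       (x ord0 i) (y ord0 i) (dotp x a) (dotp y a) (dotp x b) (dotp y b)
       (a ord0 i) (b ord0 i)).
Proof.
move=> xy; have [x0 y0 _] := xy.
have u0 : enorm y != 0 by rewrite enorm_neq0.
have r0 : enorm x != 0 by rewrite enorm_neq0.
have du := is_derive_enorm b y0.
have dp := jet_line a b jP xy; have dq := jet_line a b jQ xy.
have dx := is_derive_line x a 0 i; have dy := is_derive_line y b 0 i.
rewrite /spherical_spray; eapply is_derive_eq.
  by repeat first [exact: dp|exact: dq|exact: du|exact: dx|exact: dy|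
                   is_derive1_step].
rewrite !scale0r !add0r /dG_alg /=.
by field; rewrite ?u0 ?r0.
Qed.

(** The connection coefficient G^i_j, with [dij] the Kronecker delta and [w] the j-th component of
    the part of x normal to y. *)
Definition conn_alg (r s u p ps q qs xi xj yi yj dij : R) : R :=
  let w := xj - s * yj / u in
  (yj / u * p + ps * w) * yi + u * p * dij + (2 * yj * q + u * qs * w) * xi.

Definition conn (i j : 'I_n) (x y : 'rV[R]_n) : R :=
  let r := enorm x in let s := rs_s x y in
  conn_alg r s (enorm y) (P r s) (Ps r s) (Q r s) (Qs r s)
    (x ord0 i) (x ord0 j) (y ord0 i) (y ord0 j) (i == j)%:R.

Lemma partial_y_G i j x y : regular_at x y -> partial_y j (G i) x y = conn i j x y.
Proof.
move=> xy; have [x0 y0 _] := xy; have := is_derive_G i 0 (delta_mx ord0 j) xy.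
move/partial_yE => ->.
have u0 : enorm y != 0 by rewrite enorm_neq0.
have r0 : enorm x != 0 by rewrite enorm_neq0.
rewrite /= !dotp_delta !dotp0r !mxE eqxx /= /conn /= /conn_alg /dG_alg /=.
by field; rewrite ?u0 ?r0.
Qed.

Definition dconn_alg (r s u p pr ps prs pss q qr qs qrs qss xi xj yi yj dij
    xa ya xb yb ai aj bi bj : R) : R :=
  let du := yb / u in
  let dr := xa / r in
  let ds := (ya + xb) / u - s * yb / u ^+ 2 in
  let dp := pr * dr + ps * ds in
  let dps := prs * dr + pss * ds in
  let dq := qr * dr + qs * ds in
  let dqs := qrs * dr + qss * ds in
  let w := xj - s * yj / u in
  let dw := aj - (ds * yj / u + s * bj / u - s * yj * du / u ^+ 2) in
  (bj / u * p - yj * du / u ^+ 2 * p + yj / u * dp + dps * w + ps * dw) * yi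
  + (yj / u * p + ps * w) * bi + (du * p + u * dp) * dij
  + (2 * bj * q + 2 * yj * dq + du * qs * w + u * dqs * w + u * qs * dw) * xi
  + (2 * yj * q + u * qs * w) * ai.

Definition dconn (i j : 'I_n) (x y : 'rV[R]_n) : R -> R -> R -> R ->
    R -> R -> R -> R -> R :=
  let r := enorm x in let s := rs_s x y in
  dconn_alg r s (enorm y) (P r s) (Pr r s) (Ps r s) (Prs r s) (Pss r s)
    (Q r s) (Qr r s) (Qs r s) (Qrs r s) (Qss r s)
    (x ord0 i) (x ord0 j) (y ord0 i) (y ord0 j) (i == j)%:R.

Lemma is_derive_conn i j x y a b : regular_at x y ->
  is_derive (0 : R) 1 (fun t => conn i j (t *: a + x) (t *: b + y))
    (dconn i j x y (dotp x a) (dotp y a) (dotp x b) (dotp y b)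
       (a ord0 i) (a ord0 j) (b ord0 i) (b ord0 j)).
Proof.
move=> xy; have [x0 y0 _] := xy.
have u0 : enorm y != 0 by rewrite enorm_neq0.
have r0 : enorm x != 0 by rewrite enorm_neq0.
have du := is_derive_enorm b y0.
have ds := is_derive_rs_s x a b y0.
have dp := jet_line a b jP xy; have dq := jet_line a b jQ xy.
have dps := jet_line a b jPs xy; have dqs := jet_line a b jQs xy.
have dxi := is_derive_line x a 0 i; have dyi := is_derive_line y b 0 i.
have dxj := is_derive_line x a 0 j; have dyj := is_derive_line y b 0 j.
have u0' : enorm (0 *: b + y) != 0 by rewrite scale0r add0r.
rewrite /conn /conn_alg; eapply is_derive_eq.
  by repeat first [exact: dp|exact: dq|exact: du|exact: dxi|exact: dyi|
    exact: dxj|exact: dyj|exact: dps|exact: dqs|exact: ds|exact: u0'|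
    is_derive1_step].
rewrite !scale0r !add0r /dconn /dconn_alg /=.
by field; rewrite ?u0 ?r0.
Qed.

Lemma near0_eq_along (H1 H2 : 'rV[R]_n -> 'rV[R]_n -> R) x y a b l :
  (forall x y, regular_at x y -> H1 x y = H2 x y) -> regular_at x y ->
  is_derive (0 : R) 1 (fun t => H2 (t *: a + x) (t *: b + y)) l ->
  is_derive (0 : R) 1 (fun t => H1 (t *: a + x) (t *: b + y)) l.
Proof.
move=> H12 xy; apply: is_derive1_near.
by apply: filterS (near_regular_at a b xy) => t /H12.
Qed.

(** Linearity in the direction, spelled out so that the sums over k inside the spray get
    coefficients independent of k. *)
Lemma dconn_lin i j x y xa ya xb yb ai aj bi bj :
  let D := dconn i j x y in regular_at x y ->
  D xa ya xb yb ai aj bi bj =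
  xa * D 1 0 0 0 0 0 0 0 + ya * D 0 1 0 0 0 0 0 0 + xb * D 0 0 1 0 0 0 0 0
  + yb * D 0 0 0 1 0 0 0 0 + ai * D 0 0 0 0 1 0 0 0 + aj * D 0 0 0 0 0 1 0 0
  + bi * D 0 0 0 0 0 0 1 0 + bj * D 0 0 0 0 0 0 0 1.
Proof.
move=> D [x0 y0 _]; have u0 : enorm y != 0 by rewrite enorm_neq0.
have r0 : enorm x != 0 by rewrite enorm_neq0.
by rewrite /D /dconn /dconn_alg /=; field; rewrite u0 r0.
Qed.


Definition R1_alg (r s p pr ps q : R) : R :=
  2 * q - s / r * pr - ps + 2 * (r ^+ 2 - s ^+ 2) * ps * q + p ^+ 2
  + 2 * s * p * q.

Definition R3_alg (r s q qr qs qrs qss : R) : R :=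
  2 / r * qr - qss - s / r * qrs + 2 * (r ^+ 2 - s ^+ 2) * q * qss + 4 * q ^+ 2
  - (r ^+ 2 - s ^+ 2) * qs ^+ 2 - 2 * s * q * qs.

Definition R5_alg (r s p pr ps prs pss q qs : R) : R :=
  2 / r * pr - s / r * prs - pss - qs + 2 * p * q - 2 * s * ps * q
  + 2 * (r ^+ 2 - s ^+ 2) * pss * q - p * ps - s * p * qs
  - (r ^+ 2 - s ^+ 2) * ps * qs.

(** The curvature once all sums over k are contracted into r^2, s u and u^2. Here [g z w] is G
    paired with a vector whose products with x and y are [z] and [w]. Grouping the right-hand side
    by the normal component of x absorbs R4 = - s R3 and R2 = - R1 - s R5. *)
Lemma riemann_alg (r s u p pr ps prs pss q qr qs qrs qss xi xj yi yj dij : R) :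
  r != 0 -> u != 0 ->
  let g z w := u * p * w + u ^+ 2 * q * z in
  let sp := dconn_alg r s u p pr ps prs pss q qr qs qrs qss xi xj yi yj dij in
  2 * dG_alg r s u p pr ps q qr qs xi yi xj yj 0 0 dij 0
  - sp (s * u) (u ^+ 2) (- 2 * g (r ^+ 2) (s * u)) (- 2 * g (s * u) (u ^+ 2))
      yi yj (- 2 * g xi yi) (- 2 * g xj yj)
  - ((ps * yi + u * qs * xi)
       * ((yj / u * p + ps * (xj - s * yj / u)) * (s * u)
          + (2 * yj * q + u * qs * (xj - s * yj / u)) * r ^+ 2 + u * p * xj)
     + ((p / u - ps * s / u) * yi + (2 * q - s * qs) * xi)
       * ((yj / u * p + ps * (xj - s * yj / u)) * u ^+ 2
          + (2 * yj * q + u * qs * (xj - s * yj / u)) * (s * u) + u * p * yj)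
     + u * p * ((yj / u * p + ps * (xj - s * yj / u)) * yi
                + (2 * yj * q + u * qs * (xj - s * yj / u)) * xi + u * p * dij))
  = u ^+ 2 * R1_alg r s p pr ps q * (dij - yi * yj / u ^+ 2)
    + (u ^+ 2 * R3_alg r s q qr qs qrs qss * xi
       + u * R5_alg r s p pr ps prs pss q qs * yi) * (xj - s * yj / u).
Proof.
move=> r0 u0; rewrite /= /dconn_alg /dG_alg /R1_alg /R3_alg /R5_alg /=.
by field; rewrite r0 u0.
Qed.

(** The contractions below are all brought to this shape, if need be with zero coefficients. *)
Lemma sum_dotp_comb (z x y : 'rV[R]_n) (i j : 'I_n) (c1 c2 c3 c4 : R) :
  \sum_(k < n) z ord0 k * (x ord0 k * c1 + y ord0 k * c2
    + (i == k)%:R * c3 + (j == k)%:R * c4) =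
  dotp z x * c1 + dotp z y * c2 + z ord0 i * c3 + z ord0 j * c4.
Proof.
rewrite -(dotp_delta z i) -(dotp_delta z j) ![_ * c1]mulrC ![_ * c2]mulrC.
rewrite ![_ * c3]mulrC ![_ * c4]mulrC -!dotpZr -!dotpDr.
by apply: eq_bigr => k _; rewrite !mxE !eqxx /= !(eq_sym k); congr (_ * _); ring.
Qed.

Lemma riemann_G i j x y : regular_at x y ->
  let r := enorm x in let s := rs_s x y in let u := enorm y in
  let w := x ord0 j - s * y ord0 j / u in
  riemann G x y i j =
  u ^+ 2 * R1_alg r s (P r s) (Pr r s) (Ps r s) (Q r s)
    * ((i == j)%:R - y ord0 i * y ord0 j / u ^+ 2)
  + (u ^+ 2 * R3_alg r s (Q r s) (Qr r s) (Qs r s) (Qrs r s) (Qss r s) * x ord0 i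
     + u * R5_alg r s (P r s) (Pr r s) (Ps r s) (Prs r s) (Pss r s) (Q r s)
         (Qs r s) * y ord0 i) * w.
Proof.
move=> xy r s u w; have [x0 y0 _] := xy.
have u0 : u != 0 by rewrite enorm_neq0.
have r0 : r != 0 by rewrite enorm_neq0.
have xx : dotp x x = r ^+ 2 by rewrite enorm_sqr.
have yy : dotp y y = u ^+ 2 by rewrite enorm_sqr.
have xys : dotp x y = s * u by exact: dotp_rs_s.
have yxs : dotp y x = s * u by rewrite dotpC.
rewrite -riemann_alg//; congr (_ - _ - _).
- have := is_derive_G i (delta_mx ord0 j) 0 xy; move/partial_xE => ->.
  by rewrite /= !dotp_delta !dotp0r !mxE !eqxx.
- pose D := dconn i j x y.
  have Dlin xa ya xb yb ai aj bi bj :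
    D xa ya xb yb ai aj bi bj =
    xa * D 1 0 0 0 0 0 0 0 + ya * D 0 1 0 0 0 0 0 0 + xb * D 0 0 1 0 0 0 0 0
    + yb * D 0 0 0 1 0 0 0 0 + ai * D 0 0 0 0 1 0 0 0 + aj * D 0 0 0 0 0 1 0 0
    + bi * D 0 0 0 0 0 0 1 0 + bj * D 0 0 0 0 0 0 0 1 :=
    dconn_lin i j xa ya xb yb ai aj bi bj xy.
  have dx k : partial_x k (partial_y j (G i)) x y =
      D (x ord0 k) (y ord0 k) 0 0 (i == k)%:R (j == k)%:R 0 0.
    apply: partial_xE; apply: (near0_eq_along (partial_y_G i j) xy).
    apply: (is_derive_eq (is_derive_conn i j _ _ xy)).
    by rewrite !dotp_delta !dotp0r !mxE !eqxx.
  have dy k : partial_y k (partial_y j (G i)) x y =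
      D 0 0 (x ord0 k) (y ord0 k) 0 0 (i == k)%:R (j == k)%:R.
    apply: partial_yE; apply: (near0_eq_along (partial_y_G i j) xy).
    apply: (is_derive_eq (is_derive_conn i j _ _ xy)).
    by rewrite !dotp_delta !dotp0r !mxE !eqxx.
  (* The spray coefficients as a vector, so that contraction with them is an inner product. *)
  pose g := (u * P r s) *: y + (u ^+ 2 * Q r s) *: x.
  have gE k : g ord0 k = G k x y by rewrite !mxE.
  have -> : spray G (partial_y j (G i)) x y =
      \sum_(k < n) y ord0 k * (x ord0 k * D 1 0 0 0 0 0 0 0
        + y ord0 k * D 0 1 0 0 0 0 0 0 + (i == k)%:R * D 0 0 0 0 1 0 0 0
        + (j == k)%:R * D 0 0 0 0 0 1 0 0)
      - 2 * \sum_(k < n) g ord0 k * (x ord0 k * D 0 0 1 0 0 0 0 0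
        + y ord0 k * D 0 0 0 1 0 0 0 0 + (i == k)%:R * D 0 0 0 0 0 0 1 0
        + (j == k)%:R * D 0 0 0 0 0 0 0 1).
    rewrite mulr_sumr -sumrB; apply: eq_bigr => k _.
    rewrite dx dy gE (Dlin (x ord0 k)) (Dlin 0 0 (x ord0 k)).
    by rewrite !mul0r !addr0 !add0r mulrA.
  rewrite !sum_dotp_comb /g !dotpDl !dotpZl !gE xx yy xys yxs /spherical_spray -/r -/s -/u.
  rewrite [RHS](_ : _ = D (s * u) (u ^+ 2)
    (- 2 * (u * P r s * (s * u) + u ^+ 2 * Q r s * r ^+ 2))
    (- 2 * (u * P r s * u ^+ 2 + u ^+ 2 * Q r s * (s * u)))
    (y ord0 i) (y ord0 j)
    (- 2 * (u * P r s * y ord0 i + u ^+ 2 * Q r s * x ord0 i))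
    (- 2 * (u * P r s * y ord0 j + u ^+ 2 * Q r s * x ord0 j)))//.
  rewrite (Dlin (s * u)); move: (D 1 0 0 0 0 0 0 0) (D 0 1 0 0 0 0 0 0) (D 0 0 1 0 0 0 0 0)
    (D 0 0 0 1 0 0 0 0) (D 0 0 0 0 1 0 0 0) (D 0 0 0 0 0 1 0 0)
    (D 0 0 0 0 0 0 1 0) (D 0 0 0 0 0 0 0 1) => c1 c2 c3 c4 c5 c6 c7 c8.
  by ring.
(* G^i_k is split along x_k, y_k and the Kronecker delta; the terms with coefficient 0 only complete
   the shape of [sum_dotp_comb]. *)
have cE k : partial_y k (G i) x y * partial_y j (G k) x y =
   (Ps r s * y ord0 i + u * Qs r s * x ord0 i) * (x ord0 k *
     ((y ord0 k * (y ord0 j / u * P r s + Ps r s * w)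
      + x ord0 k * (2 * y ord0 j * Q r s + u * Qs r s * w)
      + (j == k)%:R * (u * P r s) + (j == k)%:R * 0)))
   + ((P r s / u - Ps r s * s / u) * y ord0 i
      + (2 * Q r s - s * Qs r s) * x ord0 i) * (y ord0 k *
     ((y ord0 k * (y ord0 j / u * P r s + Ps r s * w)
      + x ord0 k * (2 * y ord0 j * Q r s + u * Qs r s * w)
      + (j == k)%:R * (u * P r s) + (j == k)%:R * 0)))
   + u * P r s * ((delta_mx ord0 i : 'rV[R]_n) ord0 k *
     ((y ord0 k * (y ord0 j / u * P r s + Ps r s * w)
      + x ord0 k * (2 * y ord0 j * Q r s + u * Qs r s * w)
      + (j == k)%:R * (u * P r s) + (j == k)%:R * 0))).
  rewrite !partial_y_G// /conn /conn_alg -/r -/s -/u -/w mxE eqxx /=.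
  by rewrite (eq_sym k i) (eq_sym k j); field.
under eq_bigr do rewrite cE.
rewrite !big_split /= -!mulr_sumr !sum_dotp_comb xx yy xys yxs.
rewrite !(dotpC (delta_mx _ _)) !dotp_delta !mxE eqxx /= (eq_sym j i).
by rewrite -/w; ring.
Qed.

End RiemannCurvature.

(** * The fundamental tensor *)

Section LinearAlgebra.
Variables (R : realType) (n : nat).
Implicit Types (x y v w : 'rV[R]_n).

Lemma exists_kernel_row m (B : 'M[R]_(n, m)) : (m < n)%N ->
  exists2 v : 'rV[R]_n, v != 0 & v *m B = 0.
Proof.
move=> mn; have : kermx B != 0.
  by rewrite -mxrank_eq0 mxrank_ker subn_eq0 -ltnNge (leq_ltn_trans (rank_leq_col B)).
by move=> /rowV0Pn[v vK v0]; exists v => //; exact/sub_kermxP.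
Qed.

Lemma mulmx_dotp x y : x *m y^T = (dotp x y)%:M.
Proof.
apply/matrixP => i j; rewrite !mxE !ord1 eqxx mulr1n.
by apply: eq_bigr => k _; rewrite mxE.
Qed.

Lemma exists_orthogonal x : (1 < n)%N -> exists2 v, v != 0 & dotp x v = 0.
Proof.
move=> n1; have [v v0 vx] := exists_kernel_row x^T n1.
exists v => //; move: vx; rewrite mulmx_dotp dotpC => /matrixP/(_ 0 0).
by rewrite !mxE eqxx mulr1n.
Qed.

Lemma exists_orthogonal2 x y : (2 < n)%N ->
  exists v, [/\ v != 0, dotp x v = 0 & dotp y v = 0].
Proof.
move=> n2; have [v v0] := exists_kernel_row (row_mx x^T y^T) n2.
rewrite mul_mx_row !mulmx_dotp => /eqP; rewrite row_mx_eq0 => /andP[/eqP vx /eqP vy].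
exists v; split=> //; rewrite dotpC.
  by have /matrixP/(_ 0 0) := vx; rewrite !mxE eqxx mulr1n.
by have /matrixP/(_ 0 0) := vy; rewrite !mxE eqxx mulr1n.
Qed.

Definition normal_part x y : 'rV[R]_n := x - (rs_s x y / enorm y) *: y.

Lemma normal_partE x y j :
  normal_part x y ord0 j = x ord0 j - rs_s x y * y ord0 j / enorm y.
Proof. by rewrite !mxE mulrAC. Qed.

Lemma dotp_normal_part x y : y != 0 -> dotp y (normal_part x y) = 0.
Proof.
move=> y0; have u0 : enorm y != 0 by rewrite enorm_neq0.
rewrite dotpDr -scaleNr dotpZr -enorm_sqr dotpC (dotp_rs_s _ y0).
by field.
Qed.

Lemma dotp_normal_partx x y : y != 0 ->
  dotp x (normal_part x y) = enorm x ^+ 2 - rs_s x y ^+ 2.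
Proof.
move=> y0; have u0 : enorm y != 0 by rewrite enorm_neq0.
rewrite dotpDr -scaleNr dotpZr -enorm_sqr (dotp_rs_s _ y0).
by field.
Qed.

Lemma dotp_normal_part2 x y : y != 0 ->
  dotp (normal_part x y) (normal_part x y) = enorm x ^+ 2 - rs_s x y ^+ 2.
Proof.
move=> y0; rewrite {1}/normal_part dotpDl -scaleNr dotpZl dotp_normal_part//.
by rewrite mulr0 addr0 dotp_normal_partx.
Qed.

Lemma rs_s_le x y : y != 0 -> `|rs_s x y| <= enorm x.
Proof.
move=> y0; have := dotp_ge0 (normal_part x y); rewrite dotp_normal_part2//.
by rewrite subr_ge0 -real_normK ?num_real// ler_pXn2r// ?nnegrE ?sqrtr_ge0.
Qed.

(** Either the normal part w itself or, when w = 0, any vector orthogonal to y, since both sides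
    then vanish. On such a vector the fundamental tensor exposes the denominator of Q. *)
Lemma exists_transverse x y : (1 < n)%N -> y != 0 ->
  exists v, [/\ v != 0, dotp y v = 0 & forall k,
    dotp x v * normal_part x y ord0 k =
    (enorm x ^+ 2 - rs_s x y ^+ 2) * v ord0 k].
Proof.
move=> n1 y0; have [w0|w0] := eqVneq (normal_part x y) 0.
  have [v v0 yv] := exists_orthogonal y n1; exists v; split=> // k.
  by rewrite -dotp_normal_part2// w0 dotp0l mxE mulr0 mul0r.
exists (normal_part x y); split=> // [|k]; first exact: dotp_normal_part.
by rewrite dotp_normal_partx.
Qed.

End LinearAlgebra.

Section FundamentalTensor.
Variables (R : realType) (n : nat) (U : set (R * R)).
Hypothesis oU : open U.
Variables f fr fs frs fss : R -> R -> R.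
Hypotheses (jf : jet U f fr fs) (jfs : jet U fs frs fss).
Variables (r0 : R) (F : 'rV[R]_n -> 'rV[R]_n -> R).
Hypothesis FE : forall x y, enorm x < r0 -> y != 0 ->
  F x y = enorm y * f (enorm x) (rs_s x y).

Lemma near_fibre (H1 H2 : 'rV[R]_n -> 'rV[R]_n -> R) x y b l :
  (forall y, regular_at U x y -> H1 x y = H2 x y) -> regular_at U x y ->
  is_derive (0 : R) 1 (fun t => H2 (t *: 0 + x) (t *: b + y)) l ->
  is_derive (0 : R) 1 (fun t => H1 (t *: 0 + x) (t *: b + y)) l.
Proof.
move=> H12 xy; apply: is_derive1_near.
apply: filterS (near_regular_at oU 0 b xy) => t.
by rewrite scaler0 add0r => /H12.
Qed.

Lemma partial_y_F j x y : enorm x < r0 -> regular_at U x y ->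
  partial_y j F x y =
  f (enorm x) (rs_s x y) * y ord0 j / enorm y
  + fs (enorm x) (rs_s x y) * normal_part x y ord0 j.
Proof.
move=> xr xy; have [x0 y0 _] := xy; apply: partial_yE.
pose H (x y : 'rV[R]_n) := enorm y * f (enorm x) (rs_s x y).
have FE' z : regular_at U x z -> F x z = H x z by move=> [_ z0 _]; exact: FE.
apply: (near_fibre (H2 := H) FE' xy); rewrite /H.
have u0 : enorm y != 0 by rewrite enorm_neq0.
have r0' : enorm x != 0 by rewrite enorm_neq0.
have du := is_derive_enorm (delta_mx ord0 j) y0.
have df := jet_line 0 (delta_mx ord0 j) jf xy.
eapply is_derive_eq; first by repeat first [exact: du|exact: df|is_derive1_step].
rewrite normal_partE !scale0r !add0r !dotp_delta !dotp0r.
by field; rewrite ?u0 ?r0'.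
Qed.

(** The product of F and its derivative in y^k, multiplied out so that no division by |y| remains
    before the second differentiation. *)
Definition half_grad (k : 'I_n) (x y : 'rV[R]_n) : R :=
  let r := enorm x in let s := rs_s x y in
  f r s ^+ 2 * y ord0 k
  + f r s * fs r s * (enorm y * x ord0 k - s * y ord0 k).

Lemma partial_y_F2 k x y : enorm x < r0 -> regular_at U x y ->
  partial_y k (fun x y => F x y ^+ 2) x y = 2 * half_grad k x y.
Proof.
move=> xr xy; have [x0 y0 _] := xy; apply: partial_yE.
pose H (x y : 'rV[R]_n) := (enorm y * f (enorm x) (rs_s x y)) ^+ 2.
have FE' z : regular_at U x z -> F x z ^+ 2 = H x z.
  by move=> [_ z0 _]; rewrite FE.
apply: (near_fibre (H1 := fun x y => F x y ^+ 2) (H2 := H) FE' xy); rewrite /H.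
have u0 : enorm y != 0 by rewrite enorm_neq0.
have r0' : enorm x != 0 by rewrite enorm_neq0.
have du := is_derive_enorm (delta_mx ord0 k) y0.
have df := jet_line 0 (delta_mx ord0 k) jf xy.
eapply is_derive_eq; first by repeat first [exact: du|exact: df|is_derive1_step].
rewrite /half_grad /= !scale0r !add0r !dotp_delta !dotp0r.
by field; rewrite ?u0 ?r0'.
Qed.

(** Arranged by the index [j], so that multiplying by a row vector is a single use of
    [sum_dotp_comb]. *)
Lemma fundamental_tensorE j k x y : enorm x < r0 -> regular_at U x y ->
  let r := enorm x in let s := rs_s x y in let u := enorm y in
  let z := u * x ord0 k - s * y ord0 k in
  let c := 2 * f r s * fs r s * y ord0 k
           + (fs r s ^+ 2 + f r s * fss r s) * z - f r s * fs r s * y ord0 k in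
  fundamental_tensor F x y j k =
  x ord0 j * (c / u) + y ord0 j * (f r s * fs r s * x ord0 k / u - c * s / u ^+ 2)
  + (k == j)%:R * (f r s ^+ 2 - s * f r s * fs r s) + (k == j)%:R * 0.
Proof.
move=> xr xy r s u z c; have [x0 y0 _] := xy; rewrite mxE.
suff -> : partial_y j (partial_y k (fun x y => F x y ^+ 2)) x y =
  2 * (x ord0 j * (c / u)
    + y ord0 j * (f r s * fs r s * x ord0 k / u - c * s / u ^+ 2)
    + (k == j)%:R * (f r s ^+ 2 - s * f r s * fs r s) + (k == j)%:R * 0).
  by rewrite mulKf// pnatr_eq0.
apply: partial_yE.
pose H (x y : 'rV[R]_n) := 2 * half_grad k x y.
have FE' v : regular_at U x v -> partial_y k (fun x y => F x y ^+ 2) x v = H x v.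
  by move=> xv; exact: partial_y_F2.
apply: (near_fibre (H2 := H) FE' xy); rewrite /H /half_grad.
have u0 : enorm y != 0 by rewrite enorm_neq0.
have r0' : enorm x != 0 by rewrite enorm_neq0.
have du := is_derive_enorm (delta_mx ord0 j) y0.
have df := jet_line 0 (delta_mx ord0 j) jf xy.
have dfs := jet_line 0 (delta_mx ord0 j) jfs xy.
have ds := is_derive_rs_s x 0 (delta_mx ord0 j) y0.
have dx := is_derive_line x 0 0 k.
have dy := is_derive_line y (delta_mx ord0 j) 0 k.
eapply is_derive_eq.
  by repeat first [exact: du|exact: df|exact: dfs|exact: ds|exact: dx|exact: dy|
                   is_derive1_step].
rewrite !scale0r !add0r !dotp_delta !dotp0r !mxE !eqxx /= -/r -/s -/u /c /z.
by field; rewrite ?u0 ?r0'.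
Qed.

(** On the kernel of dF the tensor is F times the y-Hessian of F, which kills y and multiplies the
    transverse [v] by the expression in question divided by |y|. *)
Lemma hessian_neq0 x y : (1 < n)%N -> enorm x < r0 -> regular_at U x y ->
  let r := enorm x in let s := rs_s x y in
  f r s != 0 -> \rank (fundamental_tensor F x y) = n ->
  f r s - s * fs r s + (r ^+ 2 - s ^+ 2) * fss r s != 0.
Proof.
move=> n1 xr xy r s f0 rk; apply/negP => /eqP D0.
have [x0 y0 _] := xy; have [v [v0 yv vw]] := exists_transverse x n1 y0.
have u0 : enorm y != 0 by rewrite enorm_neq0.
(* Makes dF vanish on [v']: dF takes the value f_s <x, v> on [v] and |y| f on y. *)
pose c := - (fs r s * dotp x v / (enorm y * f r s)).
pose v' := v + c *: y.
have v'0 : v' = 0.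
  apply: (row_free_inj (A := fundamental_tensor F x y)).
    by rewrite /row_free rk.
  apply/rowP => k; rewrite mul0mx [RHS]mxE mxE.
  under eq_bigr do rewrite fundamental_tensorE//.
  rewrite sum_dotp_comb /v' !dotpDl !dotpZl (dotpC v y) yv (dotpC v x).
  rewrite -enorm_sqr (dotpC y x) (dotp_rs_s _ y0) -/r -/s !mxE.
  have := vw k; rewrite normal_partE -/r -/s => vwk.
  have E : f r s * ((f r s - s * fs r s) * v ord0 k
      + fss r s * (dotp x v * (x ord0 k - s * y ord0 k / enorm y))) = 0.
    rewrite vwk; transitivity (f r s * ((f r s - s * fs r s
      + (r ^+ 2 - s ^+ 2) * fss r s) * v ord0 k)); first by ring.
    by rewrite D0 mul0r mulr0.
  by rewrite -[RHS]E /c; field; rewrite u0 f0.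
move: v0; rewrite -dotp_eq0.
have : dotp v v' = 0 by rewrite v'0 dotp0r.
by rewrite dotpDr dotpZr (dotpC v y) yv mulr0 addr0 => ->; rewrite eqxx.
Qed.

End FundamentalTensor.

(** * Smoothness of the spray coefficients *)

(* Otherwise unification compares partial derivatives by unfolding them to limits. *)
Local Opaque d_r d_s.

Ltac smooth2_step :=
  match goal with
  | |- smooth2 _ (fun _ _ => ?c) => apply: smooth2_cst
  | |- smooth2 _ (fun r _ => r) => apply: smooth2_fst
  | |- smooth2 _ (fun _ s => s) => apply: smooth2_snd
  | |- smooth2 _ (fun r s => @?f r s + @?g r s) => apply: (@smooth2D _ _ f g)
  | |- smooth2 _ (fun r s => @?f r s * @?g r s) => apply: (@smooth2M _ _ f g)
  | |- smooth2 _ (fun r s => - @?f r s) => apply: (@smooth2N _ _ f)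
  | |- smooth2 _ (fun r s => @?f r s ^+ ?n) => apply: (@smooth2X _ _ f n)
  | |- smooth2 _ (fun r s => (@?f r s)^-1) => apply: (@smooth2V _ _ f)
  | |- smooth2 _ (d_r ?f) => apply: (@smooth2_d_r _ _ f)
  | |- smooth2 _ (d_s ?f) => apply: (@smooth2_d_s _ _ f)
  | |- smooth2 _ (fun r s => d_r ?f r s) => apply: (@smooth2_d_r _ _ f)
  | |- smooth2 _ (fun r s => d_s ?f r s) => apply: (@smooth2_d_s _ _ f)
  end.

Section SphericallySymmetric.
Variable R : realType.

Lemma open_smooth2_neq0 (U : set (R * R)) g : smooth2 U g ->
  open [set p : R * R | U p /\ g p.1 p.2 != 0].
Proof.
move=> sg; rewrite openE => -[r s] [/= Urs grs].
have g0 : 0 < `|g r s| by rewrite normr_gt0.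
have [d d0 hd] := smooth2_box sg Urs g0.
apply/nbhs_ballP; exists d => //= -[a b] [/= ra sb].
move: ra sb; rewrite -!ball_normE/= => ra sb.
have [Uab gab] := hd a b ltac:(by rewrite distrC) ltac:(by rewrite distrC).
split=> //; apply: contraTneq gab => ->.
by rewrite sub0r normrN ltxx.
Qed.

Lemma smooth2_jet (A : set (R * R)) f : smooth2 A f -> jet A f (d_r f) (d_s f).
Proof. by move=> sf a b t da db; exact: is_derive_smooth2_comp. Qed.

Lemma spray_Q_alg (r D N : R) : r != 0 -> D != 0 ->
  2 * (1 / (2 * r) * (N / D)) * D = N / r.
Proof. by move=> r0 D0; field; rewrite r0 D0. Qed.

Lemma spray_P_alg (r s f fr fs q W : R) : r != 0 -> f != 0 ->
  2 * (- (q / f) * W + 1 / (2 * r * f) * (s * fr + r * fs)) * f + 2 * q * W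
  = s / r * fr + fs.
Proof. by move=> r0 f0; field; rewrite r0 f0. Qed.

Section Phi.
Variables (U : set (R * R)) (phi : R -> R -> R).
Hypothesis sphi : smooth2 U phi.

Definition hess (r s : R) : R :=
  phi r s - s * d_s phi r s + (r ^+ 2 - s ^+ 2) * d_s (d_s phi) r s.

(** Off [rs_domain] the extension [phi] may vanish, so P and Q are studied on the open part of [U]
    where their denominators do not. *)
Definition spray_domain : set (R * R) :=
  [set p | U p /\ p.1 * phi p.1 p.2 * hess p.1 p.2 != 0].

Lemma smooth2_hess : smooth2 U hess.
Proof.
have [oU _] := sphi; rewrite /hess.
by repeat first [smooth2_step|exact: oU|exact: sphi].
Qed.

Lemma open_spray_domain : open spray_domain.
Proof.
have [oU _] := sphi.
apply: (@open_smooth2_neq0 U (fun r s => r * phi r s * hess r s)).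
by repeat first [smooth2_step|exact: oU|exact: sphi|exact: smooth2_hess].
Qed.

Let A := spray_domain.
Let oA : open A := open_spray_domain.

Lemma spray_domainP r s : A (r, s) -> [/\ r != 0, phi r s != 0 & hess r s != 0].
Proof. by move=> [_ /=]; rewrite !mulf_eq0 !negb_or => /andP[/andP[]]. Qed.

Let subA f : smooth2 U f -> smooth2 A f.
Proof. by apply: smooth2_subset => // p []. Qed.

Let sphiA := subA sphi.
Lemma smooth2_spray_Q : smooth2 A (spray_Q phi).
Proof.
rewrite /spray_Q; apply: smooth2M.
  repeat first [smooth2_step|exact: oA].
  by move=> r s /spray_domainP[r0 _ _]; rewrite mulf_neq0// pnatr_eq0.
apply: smooth2M.
  by repeat first [smooth2_step|exact: oA|exact: sphiA].
apply: (@smooth2V _ _ hess); first by move=> r s /spray_domainP[].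
exact: subA smooth2_hess.
Qed.

Lemma smooth2_spray_P : smooth2 A (spray_P phi).
Proof.
have phi0 r s : A (r, s) -> phi r s != 0 by move=> /spray_domainP[].
rewrite /spray_P; repeat first [smooth2_step|exact: oA|exact: sphiA|
  exact: smooth2_spray_Q|exact: phi0].
by move=> r s /spray_domainP[r0 f0 _]; rewrite !mulf_neq0// pnatr_eq0.
Qed.

Lemma spray_Q_eq r s : r != 0 -> hess r s != 0 ->
  2 * spray_Q phi r s *
    (phi r s - s * d_s phi r s + (r ^+ 2 - s ^+ 2) * d_s (d_s phi) r s) =
  (- d_r phi r s + s * d_s (d_r phi) r s + r * d_s (d_s phi) r s) / r.
Proof. exact: spray_Q_alg. Qed.

Lemma spray_P_eq r s : r != 0 -> phi r s != 0 ->
  2 * spray_P phi r s * phi r s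
  + 2 * spray_Q phi r s * (s * phi r s + (r ^+ 2 - s ^+ 2) * d_s phi r s) =
  s / r * d_r phi r s + d_s phi r s.
Proof. exact: spray_P_alg. Qed.

Local Opaque spray_P spray_Q.

Let sP := smooth2_spray_P.
Let sQ := smooth2_spray_Q.
Let P := spray_P phi.
Let Q := spray_Q phi.

Lemma smooth2_curv_R3 : smooth2 A (curv_R3 phi).
Proof.
have r0 r s : A (r, s) -> r != 0 by move=> /spray_domainP[].
by rewrite /curv_R3; repeat first [smooth2_step|exact: oA|exact: sQ|exact: r0].
Qed.

Definition curv_R5 (r s : R) : R :=
  R5_alg r s (P r s) (d_r P r s) (d_s P r s) (d_r (d_s P) r s) (d_s (d_s P) r s)
    (Q r s) (d_s Q r s).

Lemma curvature_relation r s : A (r, s) ->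
  phi r s * curv_R5 r s = - d_s phi r s * curv_R1 phi r s
  - (s * phi r s + (r ^+ 2 - s ^+ 2) * d_s phi r s) * curv_R3 phi r s.
Proof.
move=> Ars; rewrite /curv_R5 /R5_alg /curv_R1 /curv_R3.
have dr f : smooth2 A f -> forall r s, A (r, s) ->
    is_derive r 1 (fun x => f x s) (d_r f r s).
  by move=> sf r' s' A'; exact: is_derive_d_r sf A'.
have ds f : smooth2 A f -> forall r s, A (r, s) ->
    is_derive s 1 (f r) (d_s f r s).
  by move=> sf r' s' A'; exact: is_derive_d_s sf A'.
apply: (@curvature_relation_jets _ A phi (d_r phi) (d_s phi) (d_r (d_r phi))
  (d_s (d_r phi)) (d_s (d_s phi)) P (d_r P) (d_s P) (d_r (d_s P)) (d_s (d_s P))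
  Q (d_r Q) (d_s Q) (d_s (d_r Q)) (d_s (d_s Q))).
- exact: oA.
- by move=> r' s' /spray_domainP[].
- exact: dr.
- exact: ds.
- by apply: dr; exact: smooth2_d_r.
- by apply: ds; exact: smooth2_d_r.
(* Both mixed derivatives have to be given by one function, here the s-derivative of [d_r phi]; the
   same is done for Q below. *)
- by move=> r' s' A'; rewrite (d_s_d_r sphiA A'); apply: dr; first exact: smooth2_d_s.
- by apply: ds; exact: smooth2_d_s.
- exact: dr.
- exact: ds.
- by apply: dr; exact: smooth2_d_s.
- by apply: ds; exact: smooth2_d_s.
- exact: dr.
- exact: ds.
- by move=> r' s' A'; rewrite (d_s_d_r sQ A'); apply: dr; first exact: smooth2_d_s.
- by apply: ds; exact: smooth2_d_s.
- by move=> r' s' /spray_domainP[r0 _ D0]; exact: spray_Q_eq.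
- by move=> r' s' /spray_domainP[r0 f0 _]; exact: spray_P_eq.
- exact: Ars.
Qed.

End Phi.
End SphericallySymmetric.

(** * Scalar curvature *)

Section ScalarCurvature.
Variables (R : realType) (n : nat).
Implicit Types (x y v : 'rV[R]_n) (i j k : 'I_n).

(** After multiplication by <y, y> the two sides differ, for each pair of indices, by a multiple of
    <y, w>. *)
Lemma dim2_normal_part (u2 : R) (y w : 'rV[R]_2) (i j : 'I_2) :
  dotp y w = 0 -> u2 = dotp y y -> u2 != 0 ->
  w ord0 i * w ord0 j = dotp w w * ((i == j)%:R - y ord0 i * y ord0 j / u2).
Proof.
rewrite /dotp !big_ord_recl !big_ord0 !addr0 => yw uE u0.
have ordE (k : 'I_2) : k = ord0 \/ k = lift ord0 ord0.
  by case: (unliftP ord0 k) => [k' ->|->]; [right; rewrite ord1|left].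
apply: (mulIf u0); rewrite -[RHS]mulrA mulrBl divfK// uE.
set a := y ord0 ord0 in yw *; set b := y ord0 (lift ord0 ord0) in yw *.
set c := w ord0 ord0 in yw *; set d := w ord0 (lift ord0 ord0) in yw *.
have nz : (ord0 == lift ord0 ord0 :> 'I_2) = false by [].
have nz' : (lift ord0 ord0 == ord0 :> 'I_2) = false by [].
apply/eqP; rewrite -subr_eq0; apply/eqP.
case: (ordE i) => ->; case: (ordE j) => ->; rewrite ?eqxx ?nz ?nz' /= -/a -/b -/c -/d.
- by transitivity ((a * c - b * d) * (a * c + b * d)); [ring|rewrite yw mulr0].
- by transitivity ((a * d + b * c) * (a * c + b * d)); [ring|rewrite yw mulr0].
- by transitivity ((a * d + b * c) * (a * c + b * d)); [ring|rewrite yw mulr0].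
- by transitivity ((b * d - a * c) * (a * c + b * d)); [ring|rewrite yw mulr0].
Qed.

(** Substituting for R5 completes delta - y y / u^2 to the angular tensor of F in the R1 term, and
    corrects x^i by a multiple of y^i in the R3 term. *)
Lemma riemann_decomposition_alg (u p ps r1 r3 r5 s a xi yi yj w d : R) :
  p != 0 -> u != 0 -> p * r5 = - ps * r1 - (s * p + a * ps) * r3 ->
  u ^+ 2 * r1 * (d - yi * yj / u ^+ 2) + (u ^+ 2 * r3 * xi + u * r5 * yi) * w =
  u ^+ 2 * r1 * (d - yi / (u * p) * (p * yj / u + ps * w))
  + u ^+ 2 * r3 * ((xi - s * yi / u) - a * ps / p * (yi / u)) * w.
Proof.
move=> p0 u0 /(congr1 ( *%R p^-1)); rewrite mulKf// => ->.
by field; rewrite p0 u0.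
Qed.

Variables (r0 : R) (F : 'rV[R]_n -> 'rV[R]_n -> R) (phi : R -> R -> R).
Hypothesis n1 : (1 < n)%N.
Hypothesis hF : is_finsler r0 F.
Hypothesis hphi : spherically_symmetric r0 phi F.

(** The nondegeneracy of F enters here: it makes the denominator of Q nonzero at every point (|x|,
    s) with x in the ball, x and y nonzero. *)
Lemma regular_at_spray_domain : exists2 U, smooth2 U phi &
  forall x y, enorm x < r0 -> x != 0 -> y != 0 ->
    regular_at U x y /\ regular_at (spray_domain U phi) x y.
Proof.
have [[U [oU rsU sphi]] phi_gt0 FE] := hphi.
have sphi2 : smooth2 U phi by split.
exists U => // x y xr x0 y0.
have rs : rs_domain r0 (enorm x, rs_s x y) by split=> //; exact: rs_s_le.
have xyU : regular_at U x y by split=> //; exact: rsU.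
split=> //; split=> //; split=> /=; first exact: rsU.
have p0 : phi (enorm x) (rs_s x y) != 0 by rewrite gt_eqF//; exact: phi_gt0 rs.
rewrite !mulf_neq0 ?enorm_neq0//.
have jf := smooth2_jet sphi2; have jfs := smooth2_jet (smooth2_d_s sphi2).
by apply: (hessian_neq0 oU jf jfs FE n1 xr xyU p0); exact: finsler_rank hF _ _ xr y0.
Qed.

Definition angular (i j : 'I_n) x y : R :=
  (i == j)%:R - y ord0 i / F x y * partial_y j F x y.

(** The projection along y of the normal part of x to the kernel of dF. *)
Definition transverse_coef (i : 'I_n) x y : R :=
  let r := enorm x in let s := rs_s x y in
  normal_part x y ord0 i
  - (r ^+ 2 - s ^+ 2) * d_s phi r s / phi r s * (y ord0 i / enorm y).

Lemma phi_neq0 x y : enorm x < r0 -> y != 0 -> phi (enorm x) (rs_s x y) != 0.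
Proof.
move=> xr y0; have [_ phi_gt0 _] := hphi; rewrite gt_eqF//.
by apply: (phi_gt0 (enorm x, rs_s x y)); split=> //; exact: rs_s_le.
Qed.

Lemma partial_y_spherical j x y : enorm x < r0 -> x != 0 -> y != 0 ->
  let r := enorm x in let s := rs_s x y in
  partial_y j F x y =
  phi r s * y ord0 j / enorm y + d_s phi r s * normal_part x y ord0 j.
Proof.
move=> xr x0 y0 r s; have [U sphi reg] := regular_at_spray_domain.
have [oU _] := sphi; have [_ _ FE] := hphi; have [xyU _] := reg x y xr x0 y0.
exact: (partial_y_F oU (smooth2_jet sphi) FE j xr xyU).
Qed.

Lemma riemann_decomposition i j x y : enorm x < r0 -> x != 0 -> y != 0 ->
  riemann (spray_G phi (n:=n)) x y i j =
  enorm y ^+ 2 * curv_R1 phi (enorm x) (rs_s x y) * angular i j x y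
  + enorm y ^+ 2 * curv_R3 phi (enorm x) (rs_s x y) * transverse_coef i x y
    * normal_part x y ord0 j.
Proof.
move=> xr x0 y0; have [U sphi reg] := regular_at_spray_domain.
have [_ _ FE] := hphi; have [_ xyA] := reg x y xr x0 y0; have [_ _ Axy] := xyA.
have oA := open_spray_domain sphi.
have sP := smooth2_spray_P sphi; have sQ := smooth2_spray_Q sphi.
have := @riemann_G R n _ oA _ _ _ _ _ _ _ _ _ _ (smooth2_jet sP)
  (smooth2_jet (smooth2_d_s sP)) (smooth2_jet sQ) (smooth2_jet (smooth2_d_s sQ))
  i j x y xyA.
rewrite /= -(d_s_d_r sQ Axy) => ->.
have u0 : enorm y != 0 by rewrite enorm_neq0.
rewrite /angular FE// partial_y_spherical// /transverse_coef !normal_partE.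
exact: riemann_decomposition_alg (phi_neq0 xr y0) u0 (curvature_relation sphi Axy).
Qed.

Lemma R1_R3_scalar_curvature K :
  R1_R3_condition r0 phi K -> scalar_curvature r0 phi F K.
Proof.
move=> hK x y xr x0 y0 i j; have [_ _ FE] := hphi.
have [r1 r3] := hK x y xr x0 y0.
rewrite riemann_decomposition// r1 r3 mulr0 !mul0r addr0.
by rewrite -/(angular i j x y) [F x y]FE// exprMn mulrCA mulrA.
Qed.

Lemma dim2_scalar_curvature : n = 2%N ->
  exists K, scalar_curvature r0 phi F K.
Proof.
move=> n2; have [_ _ FE] := hphi.
(* In the plane the R3 term is r^2 - s^2 times R3 times the angular tensor, so it simply adds to
   R1. *)
exists (fun x y => (curv_R1 phi (enorm x) (rs_s x y)
  + (enorm x ^+ 2 - rs_s x y ^+ 2) * curv_R3 phi (enorm x) (rs_s x y))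
  / phi (enorm x) (rs_s x y) ^+ 2) => x y xr x0 y0 i j.
rewrite riemann_decomposition// -/(angular i j x y).
have u0 : enorm y != 0 by rewrite enorm_neq0.
have p0 := phi_neq0 xr y0.
have ww : normal_part x y ord0 i * normal_part x y ord0 j =
    (enorm x ^+ 2 - rs_s x y ^+ 2)
    * ((i == j)%:R - y ord0 i * y ord0 j / enorm y ^+ 2).
  rewrite -dotp_normal_part2//.
  have := dotp_normal_part x y0; have := enorm_sqr y; have := expf_neq0 2 u0.
  move: (normal_part x y) (enorm y ^+ 2) => w u2.
  (* The context depends on [n] and is cleared before [n] is replaced by 2. *)
  clear -n2; subst n => u2n0 yy yw; exact: dim2_normal_part.
have E : transverse_coef i x y * normal_part x y ord0 j =
    (enorm x ^+ 2 - rs_s x y ^+ 2) * angular i j x y.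
  rewrite /transverse_coef mulrBl ww /angular FE// partial_y_spherical//.
  move: (phi _ _) (d_s _ _ _) (normal_part _ _ _ _) p0 => p ps w p0.
  by field; rewrite p0 u0.
rewrite -(mulrA _ (transverse_coef i x y)) E [F x y]FE//.
move: (phi _ _) (curv_R1 _ _ _) (curv_R3 _ _ _) p0 => p c1 c3 p0.
by field.
Qed.

Lemma scalar_curvature_R1 K x y : (2 < n)%N -> scalar_curvature r0 phi F K ->
  enorm x < r0 -> x != 0 -> y != 0 ->
  curv_R1 phi (enorm x) (rs_s x y) = K x y * phi (enorm x) (rs_s x y) ^+ 2.
Proof.
move=> n2 hK xr x0 y0; have [_ _ FE] := hphi.
(* Such a vector exists also when x and y are parallel, so R1 is obtained without a limit. *)
have [v [v0 xv yv]] := exists_orthogonal2 x y n2.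
have u0 : enorm y != 0 by rewrite enorm_neq0.
have wv : dotp v (normal_part x y) = 0.
  by rewrite dotpC /normal_part dotpDl -scaleNr dotpZl xv yv mulr0 addr0.
(* dF vanishes on [v], hence the angular tensor fixes it. *)
have ang i : \sum_j v ord0 j * angular i j x y = v ord0 i.
  pose c := y ord0 i / F x y; pose p := phi (enorm x) (rs_s x y).
  pose ps := d_s phi (enorm x) (rs_s x y).
  transitivity (\sum_j v ord0 j * (y ord0 j * - (c * p / enorm y)
      + normal_part x y ord0 j * - (c * ps) + (i == j)%:R * 1 + (i == j)%:R * 0)).
    apply: eq_bigr => j _; rewrite /angular partial_y_spherical// -/c -/p -/ps.
    by congr (_ * _); move: c p ps => c p ps; field.
  by rewrite sum_dotp_comb (dotpC v y) yv wv !mul0r mulr0 mulr1 addr0 !add0r.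
have [i vi0] : exists i, v ord0 i != 0 by apply/rV0Pn.
have : \sum_j v ord0 j * riemann (spray_G phi (n:=n)) x y i j =
    K x y * F x y ^+ 2 * v ord0 i.
  under eq_bigr do rewrite hK// -/(angular i _ x y) mulrCA.
  by rewrite -mulr_sumr ang.
under eq_bigr do rewrite riemann_decomposition// mulrDr mulrCA [X in _ + X]mulrCA.
rewrite big_split/= -!mulr_sumr ang -/(dotp v (normal_part x y)) wv mulr0 addr0.
move=> /(mulIf vi0); rewrite FE// exprMn mulrCA => /mulfI; apply.
by rewrite expf_neq0.
Qed.

Lemma scalar_curvature_transverse_R3 K x y : (2 < n)%N ->
  scalar_curvature r0 phi F K -> enorm x < r0 -> x != 0 -> y != 0 ->
  normal_part x y != 0 -> curv_R3 phi (enorm x) (rs_s x y) = 0.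
Proof.
move=> n2 hK xr x0 y0 w0; have [_ _ FE] := hphi.
have u0 : enorm y != 0 by rewrite enorm_neq0.
have r1 := scalar_curvature_R1 n2 hK xr x0 y0.
have [j wj0] : exists j, normal_part x y ord0 j != 0 by apply/rV0Pn.
(* With R1 = K phi^2 the angular terms cancel, and the index [j] with nonzero normal component
   allows division by that component. *)
have T i : curv_R3 phi (enorm x) (rs_s x y) * transverse_coef i x y = 0.
  have := hK x y xr x0 y0 i j; rewrite riemann_decomposition// -/(angular i j x y).
  rewrite r1 [F x y]FE// exprMn [in RHS]mulrCA -[RHS]addr0 => /addrI/eqP.
  rewrite mulf_eq0 (negbTE wj0) orbF -mulrA mulf_eq0 expf_eq0 (negbTE u0) /=.
  by move/eqP.
pose c3 := curv_R3 phi (enorm x) (rs_s x y).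
pose c := (enorm x ^+ 2 - rs_s x y ^+ 2) * d_s phi (enorm x) (rs_s x y)
  / phi (enorm x) (rs_s x y) / enorm y.
(* Contraction with the normal part w removes the y term of [transverse_coef] and leaves R3
   |w|^2. *)
have : \sum_i normal_part x y ord0 i * (y ord0 i * - (c3 * c)
    + normal_part x y ord0 i * c3 + (j == i)%:R * 0 + (j == i)%:R * 0) = 0.
  apply: big1 => i _; rewrite -[RHS](mulr0 (normal_part x y ord0 i)) -[in RHS](T i).
  congr (_ * _); rewrite -/c3 /transverse_coef.
  have -> : (enorm x ^+ 2 - rs_s x y ^+ 2) * d_s phi (enorm x) (rs_s x y)
    / phi (enorm x) (rs_s x y) * (y ord0 i / enorm y) = c * y ord0 i.
    by rewrite /c mulrCA mulrC.
  by move: c3 c => c3 c; ring.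
rewrite sum_dotp_comb (dotpC _ y) dotp_normal_part// mul0r add0r !mulr0 !addr0.
by move/eqP; rewrite mulf_eq0 dotp_eq0 (negbTE w0) /= => /eqP.
Qed.

(** If x is parallel to y, then <x, v> = 0; were x also c (t v + y), this would force c = 0 and x =
    0. *)
Lemma normal_part_perturb x y v (t : R) : x != 0 -> y != 0 -> v != 0 ->
  dotp y v = 0 -> normal_part x y = 0 -> t != 0 -> t *: v + y != 0 ->
  normal_part x (t *: v + y) != 0.
Proof.
move=> x0 y0 v0 yv w0 t0 yt0; apply: contra_neq x0.
move=> /eqP; rewrite subr_eq0 => /eqP; move: (rs_s x _ / enorm _) => c xE.
have xv : dotp x v = 0.
  by move/eqP: w0; rewrite subr_eq0 => /eqP ->; rewrite dotpZl yv mulr0.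
move/eqP: xv; rewrite {1}xE dotpZl dotpDl dotpZl yv addr0 !mulf_eq0 (negbTE t0).
by rewrite dotp_eq0 (negbTE v0) !orbF xE => /eqP ->; rewrite scale0r.
Qed.

Lemma scalar_curvature_R3 K x y : (2 < n)%N -> scalar_curvature r0 phi F K ->
  enorm x < r0 -> x != 0 -> y != 0 -> curv_R3 phi (enorm x) (rs_s x y) = 0.
Proof.
move=> n2 hK xr x0 y0.
have [w0|w0] := eqVneq (normal_part x y) 0; last first.
  exact: scalar_curvature_transverse_R3 n2 hK xr x0 y0 w0.
(* For x parallel to y, y is moved to t v + y. The limit t -> 0 is taken in [curv_R3], which is
   continuous, and not in the curvature equation, where K is an arbitrary function. *)
have [v v0 yv] := exists_orthogonal y n1.
have [U sphi reg] := regular_at_spray_domain.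
have [_ xyA] := reg x y xr x0 y0; have [_ _ Axy] := xyA.
have oA := open_spray_domain sphi.
have near_reg := near_regular_at oA 0 v xyA.
have /= := is_derive1_continuous (is_derive_rs_s x 0 v y0).
move=> /continuous_withinNx; rewrite scaler0 scale0r !add0r => cs.
have c3 : (fun t : R => curv_R3 phi (enorm x) (rs_s x (t *: v + y))) @ 0^' -->
    curv_R3 phi (enorm x) (rs_s x y).
  apply: cvg_smooth2 (smooth2_curv_R3 sphi) Axy _ _; first exact: cvg_cst.
  rewrite (_ : (fun _ => _) = (fun t => rs_s (t *: 0 + x) (t *: v + y)))//.
  by apply/funext => t; rewrite scaler0 add0r.
apply/eqP; apply: contraT => r3.
have near3 : \forall t \near (0 : R)^',
    curv_R3 phi (enorm x) (rs_s x (t *: v + y)) != 0 by exact: cvgr_neq0 c3 r3.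
have near_reg' : \forall t \near (0 : R)^',
    regular_at (spray_domain U phi) (t *: 0 + x) (t *: v + y) by exact: cvg_within.
(* The punctured neighbourhood matters: the moved y is independent of x only for t nonzero. *)
have : \forall t \near (0 : R)^', False.
  near=> t.
  have t0 : t != 0 by near: t; exact: nbhs_dnbhs_neq.
  have [_ yt0 _] : regular_at (spray_domain U phi) (t *: 0 + x) (t *: v + y).
    by near: t.
  have wt := normal_part_perturb x0 y0 v0 yv w0 t0 yt0.
  have : curv_R3 phi (enorm x) (rs_s x (t *: v + y)) != 0 by near: t.
  by rewrite (scalar_curvature_transverse_R3 n2 hK xr x0 yt0 wt) eqxx.
by move/filter_ex => [].
Unshelve. all: by end_near. Qed.

Lemma scalar_curvature_R1_R3 K : (2 < n)%N -> scalar_curvature r0 phi F K ->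
  R1_R3_condition r0 phi K.
Proof.
move=> n2 hK x y xr x0 y0; split; first exact: scalar_curvature_R1 hK xr x0 y0.
exact: scalar_curvature_R3 hK xr x0 y0.
Qed.

End ScalarCurvature.

Theorem theorem1 (R : realType) (n : nat) (hn : (2 <= n)%N)
    (r0 : R) (hr0 : 0 < r0)
    (F : 'rV[R]_n -> 'rV[R]_n -> R) (phi : R -> R -> R)
    (hF : is_finsler r0 F) (hphi : spherically_symmetric r0 phi F) :
  ((exists K : 'rV[R]_n -> 'rV[R]_n -> R, scalar_curvature r0 phi F K) <->
   (n = 2%N \/
    exists K : 'rV[R]_n -> 'rV[R]_n -> R, R1_R3_condition r0 phi K)) /\
  (forall K : 'rV[R]_n -> 'rV[R]_n -> R,
     (scalar_curvature r0 phi F K -> n = 2%N \/ R1_R3_condition r0 phi K) /\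
     (R1_R3_condition r0 phi K -> scalar_curvature r0 phi F K)).
Proof.
have only_if K : scalar_curvature r0 phi F K -> n = 2%N \/ R1_R3_condition r0 phi K.
  move=> hK; move: (hn); rewrite leq_eqVlt => /predU1P[n2|n2]; first by left.
  by right; exact: scalar_curvature_R1_R3 hn hF hphi _ n2 hK.
have if_part K : R1_R3_condition r0 phi K -> scalar_curvature r0 phi F K.
  exact: R1_R3_scalar_curvature hn hF hphi _.
split=> [|K]; last by split; [exact: only_if|exact: if_part].
split=> [[K hK]|[n2|[K hK]]].
- by have [n2|r13] := only_if K hK; [left|right; exists K].
- exact: dim2_scalar_curvature hn hF hphi n2.
- by exists K; exact: if_part.
Qed.
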